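(* Let $X$ be a finite nonempty set and let $X^*$ be the free monoid on $X$. Let $\sigma$ be the left shift homeomorphism of $X^{\mathbb{N}}\times X^{\mathbb{N}}$ and $\mathcal{G}^\sigma$ the transformation groupoid of the associated $\mathbb{Z}$-action. Then the tight groupoid associated to $\mathcal{S}_{X^*}$ is isomorphic (as a topological groupoid) to $\mathcal{G}^\sigma$. In particular, $$\mathcal{Q}_{\mathrm{ts}}(X^* )\cong C(X^{\mathbb{N}}\times X^{\mathbb{N}})\rtimes_\sigma\mathbb{Z}.$$
   Context: $X^*$ is the monoid of finite words over $X$ under concatenation, with the empty word $\epsilon$ as identity. It is cancellative, and it is an LCM monoid (for all $p,q$, $pX^*\cap qX^*$ is empty or a principal right ideal and $X^*p\cap X^*q$ is empty or a principal left ideal); its only invertible element is $\epsilon$. $X^{\mathbb{N}}$ is the space of infinite sequences $x=x_1x_2\cdots$ with the product topology. A pair $(x,y)\in X^{\mathbb{N}}\times X^{\mathbb{N}}$ is thought of as the bi-infinite sequence $\cdots x_3x_2x_1.y_1y_2y_3\cdots$, and the left shift is $\sigma(x,y)=(y_1x,\ y_2y_3\cdots)$. $\mathcal{G}^\sigma=\{(n,(x,y)): n\in\mathbb{Z},\ x,y\in X^{\mathbb{N}}\}$ with source $(x,y)$, range $\sigma^n(x,y)$, product $(m,\sigma^n(x,y))(n,(x,y))=(m+n,(x,y))$, and the product topology. The inverse semigroup $\mathcal{S}_{P}$ for $P=X^*$ is $\mathcal{S}_P=\{[p,q,r]: p,q,r\in P,\ q\in rP\cap Pp\}\cup\{0\}$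 (here $[p,q,r]$ is just the triple, since $P$ has no nontrivial invertible elements), with zero $0$, $[p,q,r]^*=[r_1,q,p_1]$ where $q=rr_1=p_1p$, and product $[p,q,r][a,b,c]=[pq_1,\,r_1raa_1,\,b_1c]$ if $raP\cap qP=kP$ with $raa_1=qq_1=k$ and $Pra\cap Pb=Pl$ with $r_1ra=b_1b=l$ for some $k,l,a_1,q_1,r_1,b_1\in P$, and $0$ if $raP\cap qP$ or $Pra\cap Pb$ is empty. For an inverse semigroup $S$ with zero and idempotent semilattice $E$: a filter in $E$ is a nonempty proper subset that is upwards closed and closed under products; the set $\widehat E_0$ of filters carries the subspace topology from $\{0,1\}^E$; ultrafilters are the maximal filters, and $\widehat E_{\mathrm{tight}}$ is the closure of the set of ultrafilters. $S$ acts on $\widehat E_{\mathrm{tight}}$ by $D_e=\{\xi\in\widehat E_{\mathrm{tight}}: e\in\xi\}$ and $\alpha_s:D_{s^*s}\to D_{ss^*}$, $\alpha_s(\xi)=\{f\in E: f\geqslant ses^*\text{ for some }e\in\xi\}$. The tight groupoid $\mathcal{G}_{\mathrm{tight}}(S)$ is the transformation groupoid of this action: classes $[s,x]$ with $s\in S$, $x\in D_{s^*s}$, where $[s,x]=[t,y]$ iff $x=y$ and there is $e\in E$ with $x\in D_e$ and $se=te$; $d[s,x]=x$, $r[s,x]=\alpha_s(x)$, $[s,x]^{-1}=[s^*,\alpha_s(x)]$, $[t,\alpha_s(x)][s,x]=[ts,x]$; with the étale topology generated by $\Theta(s,U)=\{[s,x]: x\in U\}$, $U\subseteq D_{s^*s}$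 open. The boundary quotient is $\mathcal{Q}_{\mathrm{ts}}(P):=C^*_{\mathrm{tight}}(\mathcal{S}_P)$, the universal C*-algebra for tight representations of the inverse monoid $S=\mathcal{S}_P$: a unital representation $\pi$ of $S$ in a C*-algebra (multiplicative, $*$-preserving, $\pi(0)=0$) is tight if for each $e\in E$ and each finite cover $C$ of $e$ (i.e. $c\leqslant e$ for all $c\in C$ and every nonzero $f\leqslant e$ has $cf\neq0$ for some $c\in C$) one has $\bigvee_{c\in C}\pi(c)=\pi(e)$. It is known (Exel) that $C^*_{\mathrm{tight}}(S)\cong C^*(\mathcal{G}_{\mathrm{tight}}(S))$. *)

(* Defs.v *)
From HB Require Import structures.
From mathcomp Require Import all_boot all_order all_algebra.
From mathcomp Require Import all_classical all_reals all_analysis.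
From mathcomp Require Import complex.

Set Implicit Arguments.
Unset Strict Implicit.
Unset Printing Implicit Defensive.
Import Order.TTheory GRing.Theory Num.Theory.
Import numFieldNormedType.Exports.
Local Open Scope classical_set_scope.

Record invMonoid := InvMonoid {
  im_sort :> choiceType;
  imul : im_sort -> im_sort -> im_sort;
  istar : im_sort -> im_sort;
  ione : im_sort;
  izero : im_sort;
  imulA : associative imul;
  imul1s : left_id ione imul;
  imuls1 : right_id ione imul;
  imul0s : left_zero izero imul;
  imuls0 : right_zero izero imul;
  imulsVs : forall s, imul (imul s (istar s)) s = s;
  imulVsV : forall s, imul (imul (istar s) s) (istar s) = istar s;
  idem_comm : forall e f, imul e e = e -> imul f f = f -> imul e f = imul f e
}.

Declare Scope invmonoid_scope.
Delimit Scope invmonoid_scope with im.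
Notation "s ** t" := (imul s t) (at level 40, left associativity)
  : invmonoid_scope.
Notation "s ^*" := (istar s) : invmonoid_scope.
Local Open Scope invmonoid_scope.

Section InvMonoidTheory.
Variable S : invMonoid.
Implicit Types s t e f : S.

Lemma inv_unique s t t' : s ** t ** s = s -> t ** s ** t = t ->
  s ** t' ** s = s -> t' ** s ** t' = t' -> t = t'.
Proof.
move=> h1 h2 h3 h4.
have e1 : (t ** s) ** (t ** s) = t ** s by rewrite imulA h2.
have e2 : (t' ** s) ** (t' ** s) = t' ** s by rewrite imulA h4.
have e3 : (s ** t) ** (s ** t) = s ** t by rewrite imulA h1.
have e4 : (s ** t') ** (s ** t') = s ** t' by rewrite imulA h3.
have a1 : t ** s = t' ** s.
  rewrite -{1}h3 -imulA imulA (idem_comm e1 e2) -imulA.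
  by congr (_ ** _); rewrite imulA h1.
have a2 : s ** t = s ** t'.
  rewrite -{1}h3 -[LHS]imulA (idem_comm e4 e3) imulA.
  by congr (_ ** _).
by rewrite -h2 a1 -imulA a2 imulA h4.
Qed.

Lemma istarK : involutive (@istar S).
Proof. by move=> s; apply: (@inv_unique (s^*)); rewrite ?imulsVs ?imulVsV. Qed.

Lemma idem_starM s : (s^* ** s) ** (s^* ** s) = s^* ** s.
Proof. by rewrite imulA imulVsV. Qed.

Lemma idem_Mstar s : (s ** s^*) ** (s ** s^*) = s ** s^*.
Proof. by rewrite imulA imulsVs. Qed.

Lemma istarM s t : (s ** t)^* = t^* ** s^*.
Proof.
apply: (@inv_unique (s ** t)); rewrite ?imulsVs ?imulVsV //.
- rewrite -!imulA (imulA t) (imulA (s^*)) (imulA (t ** _)).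
  rewrite (idem_comm (idem_Mstar t) (idem_starM s)) -!imulA.
  by rewrite (imulA t) imulsVs !imulA imulsVs.
- rewrite -!imulA (imulA (s^*)) (imulA t) (imulA (s^* ** s)).
  rewrite (idem_comm (idem_starM s) (idem_Mstar t)) -!imulA.
  by rewrite (imulA (s^*)) imulVsV !imulA imulVsV.
Qed.

Lemma istar_idem e : e ** e = e -> e^* = e.
Proof. by move=> ee; apply: (@inv_unique e); rewrite ?imulsVs ?imulVsV ?ee. Qed.

Lemma istar1 : (ione S)^* = ione S.
Proof. by apply: istar_idem; rewrite imul1s. Qed.

Lemma idemM e f : e ** e = e -> f ** f = f -> (e ** f) ** (e ** f) = e ** f.
Proof.
by move=> ee ff; rewrite -imulA (imulA f) -(idem_comm ee ff) -imulA ff imulA ee.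
Qed.

Lemma idem_conjl s e : e ** e = e -> (s ** e ** s^*) ** s = s ** e.
Proof.
by move=> ee; rewrite -!imulA (idem_comm ee (idem_starM s)) !imulA imulsVs.
Qed.

Lemma idem_conj s e : e ** e = e ->
  (s ** e ** s^*) ** (s ** e ** s^*) = s ** e ** s^*.
Proof. by move=> ee; rewrite !imulA idem_conjl // -(imulA s) ee. Qed.

End InvMonoidTheory.

Section LeftAssociatedWords.
Variable S : invMonoid.
Implicit Types a s t e : S.

Lemma imulsVsr a s : a ** s ** s^* ** s = a ** s.
Proof. by rewrite -!imulA (imulA s) imulsVs. Qed.

Lemma imulVsVr a s : a ** s^* ** s ** s^* = a ** s^*.
Proof. by rewrite -!imulA (imulA (s^*)) imulVsV. Qed.

Lemma idem_swapr a s e : e ** e = e -> a ** e ** s ** s^* = a ** s ** s^* ** e.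
Proof.
by move=> ee; rewrite -!imulA (idem_comm ee (idem_Mstar s)) !imulA.
Qed.

Lemma idem_swapl a s e : e ** e = e -> a ** e ** s^* ** s = a ** s^* ** s ** e.
Proof.
by move=> ee; rewrite -!imulA (idem_comm ee (idem_starM s)) !imulA.
Qed.

Lemma idemr a e : e ** e = e -> a ** e ** e = a ** e.
Proof. by move=> ee; rewrite -imulA ee. Qed.

End LeftAssociatedWords.

Section Idempotents.
Variable S : invMonoid.

Definition idem : Type := {e : S | e ** e == e}.
HB.instance Definition _ := Choice.on idem.

Lemma idemP (e : idem) : val e ** val e = val e.
Proof. exact/eqP/(valP e). Qed.

Definition mkidem (e : S) (ee : e ** e = e) : idem := exist _ e (introT eqP ee).

Definition idem_le (e f : S) : Prop := e ** f = e.

Definition idem_mul (e f : idem) : idem := mkidem (idemM (idemP e) (idemP f)).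
Definition idem_source (s : S) : idem := mkidem (idem_starM s).
Definition idem_conjugate (s : S) (e : idem) : idem :=
  mkidem (idem_conj s (idemP e)).
End Idempotents.

Section TightSpectrum.
Variable S : invMonoid.

Definition idem_subsets : topologicalType :=
  prod_topology (fun _ : idem S => bool).
Implicit Types xi eta : idem_subsets.

Definition is_filter xi : Prop :=
  [/\ exists e, xi e,
      exists e, ~~ xi e,
      forall e f : idem S, xi e -> idem_le (val e) (val f) -> xi f &
      forall e f : idem S, xi e -> xi f -> xi (idem_mul e f)].

Definition is_ultrafilter xi : Prop :=
  is_filter xi /\
  forall eta, is_filter eta -> (forall e, xi e -> eta e) -> eta = xi.

(* [closure] is taken in {0,1}^E; intersecting with the set of filters gives the
   closure in the subspace of filters. *)
Definition tight_filters : set idem_subsets :=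
  [set xi | is_filter xi /\ closure [set eta | is_ultrafilter eta] xi].

Definition tight_spectrum : topologicalType := set_type tight_filters.

(* Meaningful only for [xi] in [D_{s^* s}], i.e. when [xi (idem_source s)]. *)
Definition alpha (s : S) xi : idem_subsets :=
  fun f : idem S => `[< exists2 e : idem S, xi e &
                          idem_le (val (idem_conjugate s e)) (val f) >].

Lemma idem_inj (e f : idem S) : val e = val f -> e = f.
Proof. exact: val_inj. Qed.

Lemma filter_idem_mul xi (e f : idem S) : is_filter xi ->
  xi (idem_mul e f) = xi e && xi f.
Proof.
case=> _ _ up mul; apply/idP/andP => [h|[]]; last exact: mul.
split; apply: up h _; rewrite /idem_le /=.
  by rewrite (idem_comm (idemP e) (idemP f)) -imulA idemP.
by rewrite -imulA idemP.
Qed.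

Definition conj_star (s : S) (f : idem S) : idem S := idem_conjugate (s^*) f.

Lemma alphaE s xi : is_filter xi -> xi (idem_source s) ->
  alpha s xi = (fun f => xi (conj_star s f)) :> idem_subsets.
Proof.
move=> [h0 h1 up mul] xs; apply: funext => f.
apply/asboolP/idP => /= [[e xe le]|h].
  apply: up (mul _ _ xs xe) _; rewrite /idem_le /= istarK.
  move: le; rewrite /idem_le /= => le.
  have: s^* ** (s ** val e ** s^* ** val f) ** s = s^* ** (s ** val e ** s^*) ** s.
    by rewrite le.
  rewrite -!imulA (idem_comm (idemP e) (idem_starM s)) !imulA imulVsV.
  by move=> H; exact: H.
exists (conj_star s f) => //; rewrite /idem_le /= istarK !imulA.
by rewrite -idem_swapr ?idemP // idemr ?idemP // idem_swapr ?idemP.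
Qed.

Lemma alpha_filter s xi : is_filter xi -> xi (idem_source s) ->
  is_filter (alpha s xi).
Proof.
move=> hxi xs; have [_ [e0 ne0] up mul] := hxi; rewrite (alphaE hxi xs); split.
- exists (idem_source (s^*)); suff -> : conj_star s (idem_source (s^*)) =
    idem_source s by [].
  by apply: idem_inj => /=; rewrite !istarK !imulA imulVsV.
- have z : izero S ** izero S = izero S by rewrite imul0s.
  exists (mkidem z); apply: contra ne0 => h; apply: up h _.
  by rewrite /idem_le /= !(imuls0, imul0s).
- move=> e f xe le; apply: up xe _; rewrite /idem_le /= istarK !imulA.
  move: le; rewrite /idem_le => le.
  rewrite -idem_swapr ?idemP // imulsVsr.
  by rewrite -(imulA _ (val e)) le.
- move=> e f xe xf; have := mul _ _ xe xf.
  congr (is_true (xi _)); apply: idem_inj => /=; rewrite istarK !imulA.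
  by rewrite -idem_swapr ?idemP // imulsVsr.
Qed.

Lemma alphaM s t xi : is_filter xi -> xi (idem_source (t ** s)) ->
  [/\ xi (idem_source s), alpha s xi (idem_source t) &
      alpha t (alpha s xi) = alpha (t ** s) xi].
Proof.
move=> hxi xts; have [_ _ up _] := hxi.
have xs : xi (idem_source s).
  by apply: up xts _; rewrite /idem_le /= istarM !imulA imulsVsr.
have ast : alpha s xi (idem_source t).
  rewrite alphaE //; move: xts; congr (is_true (xi _)).
  by apply: idem_inj => /=; rewrite istarM istarK !imulA.
split=> //; rewrite alphaE //; last exact: alpha_filter.
rewrite alphaE // alphaE //; apply: funext => f; congr xi; apply: idem_inj => /=.
by rewrite !istarK istarM !imulA.
Qed.

Lemma alpha1 xi : is_filter xi ->
  xi (idem_source (ione S)) /\ alpha (ione S) xi = xi.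
Proof.
move=> hxi; have [[e xe] _ up _] := hxi.
have x1 : xi (idem_source (ione S)).
  by apply: up xe _; rewrite /idem_le /= istar1 !imuls1.
split=> //; rewrite alphaE //; apply: funext => f; congr xi; apply: idem_inj.
by rewrite /= !istar1 !imuls1 imul1s.
Qed.

Lemma alphaK s xi : is_filter xi -> xi (idem_source s) ->
  alpha s xi (idem_source (s^*)) /\ alpha (s^*) (alpha s xi) = xi.
Proof.
move=> hxi xs; have [_ _ up mul] := hxi.
have E : idem_source (s^* ** s) = idem_source s.
  by apply: idem_inj; rewrite /= istarM istarK idem_starM.
have [||_ a1 ->] := @alphaM s (s^*) xi; rewrite ?E//; split=> //.
rewrite alphaE ?E //; apply: funext => f.
have -> : conj_star (s^* ** s) f = idem_mul (idem_source s) f.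
  apply: idem_inj; rewrite /= !(istar_idem (idem_starM s)) !imulA.
  by rewrite idem_swapl ?idemP // imulsVsr.
by rewrite filter_idem_mul // xs.
Qed.

Lemma alpha_le s xi eta : (forall e, xi e -> eta e) ->
  forall e, alpha s xi e -> alpha s eta e.
Proof.
move=> h f /asboolP[e xe le]; apply/asboolP; exists e => //; exact: h.
Qed.

Lemma alpha_ultra s xi : is_ultrafilter xi -> xi (idem_source s) ->
  is_ultrafilter (alpha s xi).
Proof.
move=> [hxi mx] xs; split; first exact: alpha_filter.
move=> zeta hz le.
have [as1 ak] := alphaK hxi xs.
have zs := le _ as1.
have [az zk] := alphaK hz zs; rewrite istarK in zk.
rewrite -zk; congr alpha; apply: mx; first exact: alpha_filter.
by move=> e xe; apply: (alpha_le le); rewrite ak.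
Qed.

Lemma alpha_tight s xi : tight_filters xi -> xi (idem_source s) ->
  tight_filters (alpha s xi).
Proof.
move=> [hxi cl] xs; split; first exact: alpha_filter.
rewrite (alphaE hxi xs) => B nB.
pose g (eta : idem_subsets) : idem_subsets := fun f => eta (conj_star s f).
have evc (f : idem S) : continuous (fun eta : idem_subsets => eta f).
  exact: (@proj_continuous _ (fun _ : idem S => bool) f).
have gc : continuous g.
  move=> eta; apply/cvg_sup => f; move: eta.
  apply/(@continuousP _ (initial_topology (@^~ f))) => _ [C oC <-].
  exact: (open_comp (fun eta _ => evc (conj_star s f) eta) oC).
have n1 : nbhs xi (g @^-1` B) by exact: gc.
have n2 : nbhs xi [set eta : idem_subsets | eta (idem_source s)].
  apply: (evc (idem_source s) xi [set b | b]).
  by rewrite nbhs_principalE; apply/principal_filterP.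
have [eta [ue [h1 h2]]] := cl _ (filterI n1 n2).
exists (alpha s eta); split; first exact: alpha_ultra.
by rewrite alphaE //; case: ue.
Qed.

End TightSpectrum.

(* [comp g h k] is the graph of the partial product: [gh] is defined and equal
   to [k].  The unit space is [range gid] with the subspace topology.  Continuity
   of the operations plays no role in what an isomorphism is. *)
Record topGroupoid := TopGroupoid {
  arrow :> topologicalType;
  gobj : Type;
  src : arrow -> gobj;
  rng : arrow -> gobj;
  gid : gobj -> arrow;
  ginv : arrow -> arrow;
  comp : arrow -> arrow -> arrow -> Prop;
  comp_def : forall g h, (exists k, comp g h k) <-> src g = rng h;
  comp_fun : forall g h k k', comp g h k -> comp g h k' -> k = k';
  comp_src : forall g h k, comp g h k -> src k = src h;
  comp_rng : forall g h k, comp g h k -> rng k = rng g;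
  comp_assoc : forall g h l gh hl,
    comp g h gh -> comp h l hl -> exists2 k, comp gh l k & comp g hl k;
  src_gid : forall x, src (gid x) = x;
  rng_gid : forall x, rng (gid x) = x;
  comp_gidr : forall g, comp g (gid (src g)) g;
  comp_gidl : forall g, comp (gid (rng g)) g g;
  comp_ginvl : forall g, comp (ginv g) g (gid (src g));
  comp_ginvr : forall g, comp g (ginv g) (gid (rng g))
}.

(* A functor preserves units, sources, ranges and inverses, so it is enough to
   ask that the homeomorphism preserve products in both directions. *)
Definition topGroupoid_iso (G H : topGroupoid) : Prop :=
  exists phi : G -> H, exists psi : H -> G,
    [/\ cancel phi psi, cancel psi phi, continuous phi, continuous psi &
        forall g h k, comp g h k <-> comp (phi g) (phi h) (phi k)].

Section TightGroupoid.
Variable S : invMonoid.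

(* Pairs [(s, x)] with [x] in [D_{s^* s}]. *)
Definition action_pair : Type :=
  {p : S * tight_spectrum S | set_val p.2 (idem_source p.1)}.
HB.instance Definition _ := Choice.on action_pair.

Implicit Types p q : action_pair.

Definition pair_elt p : S := (val p).1.
Definition pair_src p : tight_spectrum S := (val p).2.

Lemma spectrum_tight (x : tight_spectrum S) : tight_filters (set_val x).
Proof. exact: set_valP. Qed.

Lemma spectrum_filter (x : tight_spectrum S) : is_filter (set_val x).
Proof. by case: (spectrum_tight x). Qed.

Lemma pair_dom p : set_val (pair_src p) (idem_source (pair_elt p)).
Proof. exact: (valP p). Qed.

Definition pair_rng p : tight_spectrum S :=
  SigSub (mem_set (alpha_tight (spectrum_tight (pair_src p)) (pair_dom p))).

Definition germ_eq p q : bool :=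
  `[< pair_src p = pair_src q /\
      exists2 e : idem S, set_val (pair_src p) e &
        pair_elt p ** val e = pair_elt q ** val e >].

Lemma germ_eq_equiv : equiv_class_of germ_eq.
Proof.
split.
- move=> p; apply/asboolP; split=> //.
  by exists (idem_source (pair_elt p)) => //; exact: (pair_dom p).
- suff sym p q : germ_eq p q -> germ_eq q p by move=> p q; apply/idP/idP; exact: sym.
  by move=> /asboolP[e1 [e xe e2]]; apply/asboolP; split=> //; exists e; rewrite -?e1.
- move=> q p r /asboolP[e1 [e xe e2]] /asboolP[e3 [f xf e4]]; apply/asboolP.
  split; first by rewrite e1.
  exists (idem_mul e f); first by rewrite filter_idem_mul ?xe ?e1 //; exact: spectrum_filter.
  rewrite /= imulA e2 -imulA (idem_comm (idemP e) (idemP f)) imulA e4.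
  by rewrite -imulA (idem_comm (idemP f) (idemP e)) imulA.
Qed.

Canonical germ_equiv := EquivRelPack germ_eq_equiv.

Definition tight_arrow : Type := {eq_quot germ_equiv}%qT.
HB.instance Definition _ := Choice.on tight_arrow.

Definition germ p : tight_arrow := (\pi_({eq_quot germ_equiv}) p)%qT.

Definition Theta (s : S) (U : set (tight_spectrum S)) : set tight_arrow :=
  [set g | exists2 p, germ p = g & pair_elt p = s /\ U (pair_src p)].

(* The sets [Theta s U] with [U] open and contained in [D_{s^* s}]. *)
Definition Theta_base : set (set tight_arrow) :=
  [set B | exists s, exists2 U : set (tight_spectrum S),
     open U /\ (forall x : tight_spectrum S, U x -> set_val x (idem_source s)) &
     B = Theta s U].

HB.instance Definition _ :=
  isSubBaseTopological.Build tight_arrow Theta_base id.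

Definition mkpair (s : S) (x : tight_spectrum S)
  (sx : set_val x (idem_source s)) : action_pair := exist _ (s, x) sx.

Lemma germP p q : germ p = germ q <-> germ_eq p q.
Proof. by split=> /(@eqmodP _ germ_equiv). Qed.

Lemma pair_src_eq p q : germ p = germ q -> pair_src p = pair_src q.
Proof. by move=> /germP/asboolP[]. Qed.

Lemma germ_repr (g : tight_arrow) : germ (repr g) = g.
Proof. exact: reprK. Qed.

Lemma spectrum_inj (x y : tight_spectrum S) : set_val x = set_val y -> x = y.
Proof. exact: val_inj. Qed.

Lemma pair_rng_eq p q : germ p = germ q -> pair_rng p = pair_rng q.
Proof.
move=> /germP/asboolP[e1 [e xe e2]]; apply: spectrum_inj.
rewrite !set_valE /= !alphaE; try exact: pair_dom; try exact: spectrum_filter.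
apply: funext => f; rewrite -e1.
have hx := spectrum_filter (pair_src p).
have E s : set_val (pair_src p) (conj_star s f) =
    set_val (pair_src p) (idem_mul (idem_mul e (conj_star s f)) e).
  by rewrite !filter_idem_mul // xe andbT.
rewrite E [RHS]E; congr (set_val _ _); apply: idem_inj => /=; rewrite !istarK.
have w s : val e ** (s^* ** val f ** s) ** val e =
    (s ** val e)^* ** val f ** (s ** val e).
  by rewrite istarM (istar_idem (idemP e)) !imulA.
by rewrite !w e2.
Qed.

Definition tight_src (g : tight_arrow) : tight_spectrum S := pair_src (repr g).
Definition tight_rng (g : tight_arrow) : tight_spectrum S := pair_rng (repr g).

Lemma tight_srcE p : tight_src (germ p) = pair_src p.
Proof. by apply: pair_src_eq; rewrite germ_repr. Qed.

Lemma tight_rngE p : tight_rng (germ p) = pair_rng p.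
Proof. by apply: pair_rng_eq; rewrite germ_repr. Qed.

(* [t, alpha_s(x)] [s, x] = [ts, x] *)
Definition tight_comp (g h k : tight_arrow) : Prop :=
  exists p q r : action_pair,
    [/\ germ p = g, germ q = h & germ r = k] /\
    [/\ pair_src p = pair_rng q, pair_elt r = pair_elt p ** pair_elt q &
        pair_src r = pair_src q].

Definition tight_id (x : tight_spectrum S) : tight_arrow :=
  germ (mkpair (proj1 (alpha1 (spectrum_filter x)))).

Lemma pair_inv_subproof p :
  set_val (pair_rng p) (idem_source ((pair_elt p)^*)).
Proof. exact: (proj1 (alphaK (spectrum_filter (pair_src p)) (pair_dom p))). Qed.

Definition pair_inv p : action_pair := mkpair (@pair_inv_subproof p).

Definition tight_inv (g : tight_arrow) : tight_arrow := germ (pair_inv (repr g)).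

Lemma pair_mul_subproof p q : pair_src p = pair_rng q ->
  set_val (pair_src q) (idem_source (pair_elt p ** pair_elt q)).
Proof.
move=> pq; have := pair_dom p; rewrite pq.
rewrite set_valE /= alphaE; [|exact: spectrum_filter|exact: pair_dom].
congr (is_true (set_val _ _)); apply: idem_inj => /=.
by rewrite istarM istarK !imulA.
Qed.

Definition pair_mul p q (pq : pair_src p = pair_rng q) : action_pair :=
  mkpair (pair_mul_subproof pq).

Lemma tight_comp_germ p q (pq : pair_src p = pair_rng q) :
  tight_comp (germ p) (germ q) (germ (pair_mul pq)).
Proof. by exists p, q, (pair_mul pq). Qed.

Lemma pair_eq p q : pair_elt p = pair_elt q -> pair_src p = pair_src q -> p = q.
Proof.
rewrite /pair_elt /pair_src => h1 h2; apply: val_inj.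
by rewrite [LHS]surjective_pairing [RHS]surjective_pairing h1 h2.
Qed.

Lemma pair_mul_rng p q (pq : pair_src p = pair_rng q) :
  pair_rng (pair_mul pq) = pair_rng p.
Proof.
apply: spectrum_inj; rewrite !set_valE /=.
have [_ _ <-] := alphaM (spectrum_filter (pair_src q)) (pair_mul_subproof pq).
by rewrite -/(pair_src p) pq.
Qed.

Lemma tight_compE g h k : tight_comp g h k -> forall p q,
  germ p = g -> germ q = h ->
  exists pq : pair_src p = pair_rng q, germ (pair_mul pq) = k.
Proof.
move=> [p' [q' [r' [[<- <- <-] [e1 e2 e3]]]]] p q hp hq.
have pq : pair_src p = pair_rng q.
  by rewrite (pair_src_eq hp) (pair_rng_eq hq).
exists pq; apply/germP/asboolP.
split; first by rewrite e3 -(pair_src_eq hq).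
move/germP/asboolP: hp => [sp [e' xe' E']].
move/germP/asboolP: hq => [sq [e xe E]].
have hx := spectrum_filter (pair_src q).
exists (idem_mul (conj_star (pair_elt q) e') e).
  rewrite filter_idem_mul // xe andbT.
  move: xe'; rewrite pq set_valE /= alphaE //; exact: pair_dom.
rewrite e2 /= istarK.
have w (t s : S) : t ** s ** (s^* ** val e' ** s ** val e) =
    t ** val e' ** (s ** val e).
  rewrite !imulA -(idem_swapr t s (idemP e')).
  by rewrite imulsVsr.
set f := _ ** val e.
have fe : val e ** f = f.
  have ff := idem_conj ((pair_elt q)^*) (idemP e'); rewrite istarK in ff.
  by rewrite /f (idem_comm ff (idemP e)) imulA idemP.
have qf : pair_elt q' ** f = pair_elt q ** f by rewrite -fe imulA -E -imulA.
rewrite [LHS]/= -!(imulA _ _ f) qf imulA [RHS]imulA.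
by rewrite [LHS]w [RHS]w E'.
Qed.

Lemma tight_comp_def g h :
  (exists k, tight_comp g h k) <-> tight_src g = tight_rng h.
Proof.
split=> [[k /tight_compE/(_ (repr g) (repr h))]|gh].
  by case=> [||pq _] //; exact: germ_repr.
exists (germ (pair_mul (gh : pair_src (repr g) = pair_rng (repr h)))).
by rewrite -{1}(germ_repr g) -{1}(germ_repr h); exact: tight_comp_germ.
Qed.

Lemma tight_comp_fun g h k k' :
  tight_comp g h k -> tight_comp g h k' -> k = k'.
Proof.
move=> /tight_compE/(_ (repr g) (repr h))[||pq <-]; try exact: germ_repr.
move=> /tight_compE/(_ (repr g) (repr h))[||pq' <-]; try exact: germ_repr.
by congr germ; apply: pair_eq.
Qed.

Lemma tight_comp_src g h k : tight_comp g h k -> tight_src k = tight_src h.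
Proof. by move=> [p [q [r [[_ <- <-] [_ _ e]]]]]; rewrite !tight_srcE. Qed.

Lemma tight_comp_rng g h k : tight_comp g h k -> tight_rng k = tight_rng g.
Proof.
move=> /tight_compE/(_ (repr g) (repr h))[||pq <-]; try exact: germ_repr.
by rewrite tight_rngE pair_mul_rng.
Qed.

Lemma tight_comp_assoc g h l gh hl : tight_comp g h gh -> tight_comp h l hl ->
  exists2 k, tight_comp gh l k & tight_comp g hl k.
Proof.
move=> /tight_compE/(_ (repr g) (repr h))[||pq <-]; try exact: germ_repr.
move=> /tight_compE/(_ (repr h) (repr l))[||qr <-]; try exact: germ_repr.
have e1 : pair_src (pair_mul pq) = pair_rng (repr l) by [].
have e2 : pair_src (repr g) = pair_rng (pair_mul qr) by rewrite pair_mul_rng.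
exists (germ (pair_mul e1)).
  by rewrite -{1}(germ_repr l); exact: tight_comp_germ.
suff -> : pair_mul e1 = pair_mul e2.
  by rewrite -{1}(germ_repr g); exact: tight_comp_germ.
by apply: pair_eq => //; rewrite /pair_elt /= imulA.
Qed.

Lemma tight_src_id x : tight_src (tight_id x) = x.
Proof. exact: tight_srcE. Qed.

Lemma tight_rng_id x : tight_rng (tight_id x) = x.
Proof.
rewrite tight_rngE; apply: spectrum_inj.
exact: (proj2 (alpha1 (spectrum_filter x))).
Qed.

Lemma tight_comp_idr g : tight_comp g (tight_id (tight_src g)) g.
Proof.
have := tight_rng_id (tight_src g); rewrite tight_rngE => e.
exists (repr g); eexists; exists (repr g); split; first by split; rewrite ?germ_repr.
by split; rewrite ?e // /pair_elt /= imuls1.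
Qed.

Lemma tight_comp_idl g : tight_comp (tight_id (tight_rng g)) g g.
Proof.
eexists; exists (repr g), (repr g); split; first by split; rewrite ?germ_repr.
by split; rewrite // /pair_elt /= imul1s.
Qed.

Lemma germ_idem_id p : pair_elt p ** pair_elt p = pair_elt p ->
  germ p = tight_id (pair_src p).
Proof.
move=> pp; apply/germP/asboolP; split=> //.
exists (idem_source (pair_elt p)); first exact: pair_dom.
by rewrite /= imul1s (istar_idem pp) !pp.
Qed.

Lemma tight_comp_invl g : tight_comp (tight_inv g) g (tight_id (tight_src g)).
Proof.
have e : pair_src (pair_inv (repr g)) = pair_rng (repr g) by [].
rewrite -{2}(germ_repr g) (_ : tight_id _ = germ (pair_mul e)).
  exact: tight_comp_germ.
by rewrite germ_idem_id // idem_starM.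
Qed.

Lemma pair_rng_inv p : pair_rng (pair_inv p) = pair_src p.
Proof.
apply: spectrum_inj.
exact: (proj2 (alphaK (spectrum_filter (pair_src p)) (pair_dom p))).
Qed.

Lemma tight_comp_invr g : tight_comp g (tight_inv g) (tight_id (tight_rng g)).
Proof.
have e : pair_src (repr g) = pair_rng (pair_inv (repr g)).
  by rewrite pair_rng_inv.
rewrite -{1}(germ_repr g) (_ : tight_id _ = germ (pair_mul e)).
  exact: tight_comp_germ.
by rewrite germ_idem_id // idem_Mstar.
Qed.

Definition tight_groupoid : topGroupoid := TopGroupoid
  tight_comp_def tight_comp_fun tight_comp_src tight_comp_rng tight_comp_assoc
  tight_src_id tight_rng_id tight_comp_idr tight_comp_idl
  tight_comp_invl tight_comp_invr.

End TightGroupoid.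

Section TransformationGroupoid.
Local Open Scope ring_scope.

Record intAction (Y : topologicalType) := IntAction {
  iact :> int -> Y -> Y;
  iact0 : forall y, iact 0 y = y;
  iactD : forall m n y, iact (m + n) y = iact m (iact n y);
  iact_continuous : forall n, continuous (iact n)
}.

Variables (Y : topologicalType) (theta : intAction Y).

Definition trans_arrow : topologicalType := (discrete_topology int * Y)%type.
Definition trans_elt (n : int) (y : Y) : trans_arrow := (n, y).

Definition trans_src (g : trans_arrow) : Y := g.2.
Definition trans_rng (g : trans_arrow) : Y := theta g.1 g.2.
Definition trans_id (y : Y) : trans_arrow := trans_elt 0 y.
Definition trans_inv (g : trans_arrow) : trans_arrow :=
  trans_elt (- (g.1 : int)) (trans_rng g).
Definition trans_comp (g h k : trans_arrow) : Prop :=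
  trans_src g = trans_rng h /\ k = trans_elt ((g.1 : int) + (h.1 : int)) h.2.

Program Definition trans_groupoid : topGroupoid :=
  @TopGroupoid trans_arrow Y trans_src trans_rng trans_id trans_inv trans_comp
    _ _ _ _ _ _ _ _ _ _ _.
Next Obligation. by split=> [[k []]//|e]; eexists; split. Qed.
Next Obligation. by move=> g h k k' [_ ->] [_ ->]. Qed.
Next Obligation. by move=> g h k [_ ->]. Qed.
Next Obligation.
by move=> g h k [e ->]; rewrite /trans_rng /= iactD -[theta h.1 _]e.
Qed.
Next Obligation.
move=> g h l gh hl [e1 ->] [e2 ->]; eexists; split=> //=.
  by rewrite e1 /trans_rng /= iactD -[theta l.1 _]e2.
by rewrite addrA.
Qed.
Next Obligation. by []. Qed.
Next Obligation. by move=> x; rewrite /trans_rng iact0. Qed.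
Next Obligation.
by move=> g; split; rewrite /trans_rng /= ?iact0 // addr0 /trans_elt -surjective_pairing.
Qed.
Next Obligation.
by move=> g; split=> //; rewrite /= add0r /trans_elt -surjective_pairing.
Qed.
Next Obligation. by move=> g; split=> //=; rewrite addNr. Qed.
Next Obligation.
move=> g; split; rewrite /trans_rng /= ?addrN //.
by rewrite -iactD addNr iact0.
Qed.

End TransformationGroupoid.

Section WordLcm.
Variable X : eqType.
Implicit Types u v w : seq X.

(* [rlcm u v = Some (a, b)] when [u ++ a = v ++ b] generates the right ideal
   [u X^* :&: v X^*]; dually [llcm u v = Some (a, b)] when [a ++ u = b ++ v]
   generates [X^* u :&: X^* v].  [None] means that the intersection is empty. *)
Definition rlcm u v : option (seq X * seq X) :=
  if prefix u v then Some (drop (size u) v, [::])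
  else if prefix v u then Some ([::], drop (size v) u) else None.

Definition llcm u v : option (seq X * seq X) :=
  if suffix u v then Some (take (size v - size u) v, [::])
  else if suffix v u then Some ([::], take (size u - size v) u) else None.

Lemma prefix_size u v w :
  prefix u w -> prefix v w -> size u <= size v -> prefix u v.
Proof.
rewrite !prefixE => /eqP hu /eqP hv le.
by rewrite -[X in take _ X]hv take_takel // hu.
Qed.

Lemma cat_cancell u v w : u ++ v = u ++ w -> v = w.
Proof. by move/eqP; rewrite eqseq_cat // eqxx => /eqP. Qed.

Lemma cat_cancelr u v w : v ++ u = w ++ u -> v = w.
Proof. by move/(congr1 rev); rewrite !rev_cat => /cat_cancell/(can_inj revK). Qed.

Lemma rlcmP u v :
  match rlcm u v with
  | Some (a, b) => u ++ a = v ++ b /\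
      forall w, (prefix u w && prefix v w) = prefix (u ++ a) w
  | None => forall w, ~~ (prefix u w && prefix v w)
  end.
Proof.
rewrite /rlcm; case: ifP => [uv|nuv].
  have e : u ++ drop (size u) v = v.
    by move: uv => /prefixP[s ->]; rewrite drop_size_cat.
  rewrite e cats0; split=> // w; case vw: (prefix v w); rewrite ?andbF // andbT.
  exact: prefix_trans vw.
case: ifP => [vu|nvu].
  have e : v ++ drop (size v) u = u.
    by move: vu => /prefixP[s ->]; rewrite drop_size_cat.
  rewrite e cats0; split=> // w; case uw: (prefix u w) => //=.
  exact: prefix_trans uw.
move=> w; apply/negP => /andP[uw vw].
case/orP: (leq_total (size u) (size v)) => le.
  by rewrite (prefix_size uw vw le) in nuv.
by rewrite (prefix_size vw uw le) in nvu.
Qed.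

Lemma llcm_rev u v :
  llcm u v = omap (fun ab => (rev ab.1, rev ab.2)) (rlcm (rev u) (rev v)).
Proof.
rewrite /llcm /rlcm !prefix_rev.
case: ifP => _; first by rewrite /= size_rev drop_rev revK.
by case: ifP => _ //; rewrite /= size_rev drop_rev revK.
Qed.

Lemma llcmP u v :
  match llcm u v with
  | Some (a, b) => a ++ u = b ++ v /\
      forall w, (suffix u w && suffix v w) = suffix (a ++ u) w
  | None => forall w, ~~ (suffix u w && suffix v w)
  end.
Proof.
rewrite llcm_rev; have := rlcmP (rev u) (rev v); case: rlcm => [[a b] [e h]|h] /=.
  split; first by apply: (can_inj revK); rewrite !rev_cat !revK.
  by move=> w; rewrite -!prefix_rev h rev_cat revK.
by move=> w; rewrite -!prefix_rev; exact: h.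
Qed.

End WordLcm.

Section FreeMonoidInverseMonoid.
Variable X : finType.

(* [(p, q, r)] with [q] in [r X^*] and in [X^* p]. *)
Definition triple : Type :=
  {t : seq X * seq X * seq X | prefix t.2 t.1.2 && suffix t.1.1 t.1.2}.
HB.instance Definition _ := Choice.on triple.

(* [None] is the zero; the word monoid has no nontrivial invertible element, so
   [p, q, r] is the triple itself. *)
Definition SP : Type := option triple.
HB.instance Definition _ := Choice.on SP.

(* [insub] is [None] if the side condition on [p, q, r] fails; this does not
   happen in [SP_mul] and [SP_star], by [bracket_mulE] and [bracket_starE]. *)
Definition bracket (p q r : seq X) : SP := insub (p, q, r).

Definition SP_mul (s t : SP) : SP :=
  match s, t with
  | Some s', Some t' =>
      let: (p, q, r) := val s' in
      let: (a, b, c) := val t' in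
      match rlcm (r ++ a) q, llcm (r ++ a) b with
      | Some (a1, q1), Some (r1, b1) =>
          bracket (p ++ q1) (r1 ++ r ++ a ++ a1) (b1 ++ c)
      | _, _ => None
      end
  | _, _ => None
  end.

(* q = r r1 = p1 p *)
Definition SP_star (s : SP) : SP :=
  if s is Some s' then
    let: (p, q, r) := val s' in
    bracket (drop (size r) q) q (take (size q - size p) q)
  else None.

Definition SP_one : SP := bracket [::] [::] [::].

(* [p, q, r] with [q = r r1 = p1 p] acts on dotted words by moving the dot:
   [u r . r1 v] is sent to [u p1 . p v].  This faithful action by partial
   injections is only used to check the axioms of an inverse monoid. *)
Definition dots (s : SP) (x y : seq X * seq X) : Prop :=
  match s with
  | Some s' => let: (p, q, r) := val s' in
      exists r1 p1 u v, [/\ q = r ++ r1, q = p1 ++ p,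
        x = (u ++ r, r1 ++ v) & y = (u ++ p1, p ++ v)]
  | None => False
  end.

Definition valid (p q r : seq X) := prefix r q && suffix p q.

Lemma bracket_val p q r (h : valid p q r) :
  exists2 s', bracket p q r = Some s' & val s' = (p, q, r).
Proof. by rewrite /bracket; case: insubP => [s' _ e|/negP//]; exists s'. Qed.

Lemma tripleP (s' : triple) : exists r r1 p1 p,
  r ++ r1 = p1 ++ p /\ val s' = (p, r ++ r1, r).
Proof.
case: s' => [[[p q] r] /= /andP[/prefixP[r1 e1] /suffixP[p1 e2]]].
by exists r, r1, p1, p; rewrite -e1.
Qed.

Lemma dots_bracket r r1 p1 p x y : r ++ r1 = p1 ++ p ->
  dots (bracket p (r ++ r1) r) x y <->
  exists u v, x = (u ++ r, r1 ++ v) /\ y = (u ++ p1, p ++ v).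
Proof.
move=> e; have [|s' -> e'] := @bracket_val p (r ++ r1) r.
  by rewrite /valid prefix_prefix e suffix_suffix.
rewrite /dots e'; split=> [[r2 [p2 [u [v [e1 e2 -> ->]]]]]|[u [v [-> ->]]]].
  exists u, v; rewrite (cat_cancell e1); split=> //.
  by move: e2; rewrite e => /cat_cancelr ->.
by exists r1, p1, u, v.
Qed.

Lemma SP_cases (s : SP) : s = None \/ exists r r1 p1 p,
  r ++ r1 = p1 ++ p /\ s = bracket p (r ++ r1) r.
Proof.
case: s => [s'|]; last by left.
right; have [r [r1 [p1 [p [e1 e2]]]]] := tripleP s'.
exists r, r1, p1, p; split=> //; rewrite /bracket -e2.
by case: insubP => [t _ /val_inj ->//|]; rewrite (valP s').
Qed.

Lemma dots_min r r1 p1 p : r ++ r1 = p1 ++ p ->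
  dots (bracket p (r ++ r1) r) (r, r1) (p1, p).
Proof. by move=> e; apply/(dots_bracket _ _ e); exists [::], [::]; rewrite !cats0. Qed.

Lemma cat_nil2 (u u' v : seq X) : v = u ++ u' ++ v -> u = [::] /\ u' = [::].
Proof.
by rewrite catA => /(@cat_cancelr _ _ [::])/esym/eqP; case: u; case: u'.
Qed.

Lemma dots_inj s t : (forall x y, dots s x y <-> dots t x y) -> s = t.
Proof.
move=> h; case: (SP_cases s) => [es|[r [r1 [p1 [p [e es]]]]]]; subst s.
  case: (SP_cases t) => [-> //|[r [r1 [p1 [p [e et]]]]]]; subst t.
  by have /h := dots_min e.
have /h := dots_min e.
case: (SP_cases t) => [-> //|[c [c1 [a1 [a [e' et]]]]]]; subst t.
move=> /(dots_bracket _ _ e')[u [v [[er er1] [ep1 ep]]]].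
have /h := dots_min e'.
move=> /(dots_bracket _ _ e)[u' [v' [[ec ec1] [ea1 ea]]]].
have [? ?] : u = [::] /\ u' = [::] by apply: (@cat_nil2 _ _ r); rewrite -ec.
have [? ?] : v = [::] /\ v' = [::].
  suff [] : rev v = [::] /\ rev v' = [::].
    by move=> /(congr1 rev) + /(congr1 rev); rewrite !revK.
  apply: (@cat_nil2 _ _ (rev r1)).
  by rewrite -rev_cat -ec1 -rev_cat -er1.
by subst u u' v v'; move: er er1 ep; rewrite /= !cats0 => -> -> ->.
Qed.

Lemma SP_mulE p q r a b c : valid p q r -> valid a b c ->
  SP_mul (bracket p q r) (bracket a b c) =
  match rlcm (r ++ a) q, llcm (r ++ a) b with
  | Some (a1, q1), Some (r1, b1) =>
      bracket (p ++ q1) (r1 ++ r ++ a ++ a1) (b1 ++ c)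
  | _, _ => None
  end.
Proof.
move=> h1 h2; have [s' -> es] := bracket_val h1.
by have [t' -> et] := bracket_val h2; rewrite /SP_mul es et.
Qed.

Lemma valid_cat r r1 p1 p : r ++ r1 = p1 ++ p -> valid p (r ++ r1) r.
Proof. by move=> e; rewrite /valid prefix_prefix e suffix_suffix. Qed.

Lemma bracket_mulE p q r a b c a1 q1 r1 b1 : valid p q r -> valid a b c ->
  rlcm (r ++ a) q = Some (a1, q1) -> llcm (r ++ a) b = Some (r1, b1) ->
  valid (p ++ q1) (r1 ++ r ++ a ++ a1) (b1 ++ c).
Proof.
move=> /andP[_ /suffixP[p1 eq]] /andP[/prefixP[c1 eb] _] e1 e2.
have := rlcmP (r ++ a) q; rewrite e1 => -[h1 _].
have := llcmP (r ++ a) b; rewrite e2 => -[h2 _].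
have k1 : r1 ++ r ++ a ++ a1 = (b1 ++ c) ++ c1 ++ a1.
  by rewrite (catA r) (catA r1 (r ++ a)) h2 eb -!catA.
have k2 : r1 ++ r ++ a ++ a1 = (r1 ++ p1) ++ p ++ q1.
  by rewrite (catA r) h1 eq -!catA.
by rewrite /valid {1}k1 k2 prefix_prefix suffix_suffix.
Qed.

Lemma dots_mul s t x z :
  dots (SP_mul s t) x z <-> exists y, dots t x y /\ dots s y z.
Proof.
case: (SP_cases s) => [->|[r [r1 [p1 [p [e ->]]]]]].
  by split=> // -[y []].
case: (SP_cases t) => [->|[c [c1 [a0 [a [e' ->]]]]]].
  by rewrite /SP_mul; case: (bracket _ _ _) => [?|]; split=> // -[y []].
have vs := valid_cat e; have vt := valid_cat e'.
rewrite SP_mulE //.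
have split_dots y : dots (bracket a (c ++ c1) c) x y ->
    dots (bracket p (r ++ r1) r) y z -> exists u v u' v',
    [/\ x = (u ++ c, c1 ++ v), z = (u' ++ p1, p ++ v'),
        u ++ a0 = u' ++ r & a ++ v = r1 ++ v'].
  move=> /(dots_bracket _ _ e')[u [v [-> ->]]].
  by move=> /(dots_bracket _ _ e)[u' [v' [[h1 h2] ->]]]; exists u, v, u', v'.
have := rlcmP (r ++ a) (r ++ r1).
case E1: rlcm => [[al ka]|]; last first.
  move=> n1; split=> // -[y [d1 d2]].
  have [u [v [u' [v' [_ _ _ e2]]]]] := split_dots _ d1 d2.
  have := n1 (r ++ a ++ v).
  by rewrite {2}e2 !catA !prefix_prefix.
move=> [h1 m1].
have := llcmP (r ++ a) (c ++ c1).
case E2: llcm => [[be ga]|]; last first.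
  move=> n2; split=> // -[y [d1 d2]].
  have [u [v [u' [v' [_ _ e1 _]]]]] := split_dots _ d1 d2.
  have := n2 (u ++ a0 ++ a).
  by rewrite e' suffix_suffix catA e1 -catA suffix_suffix.
move=> [h2 m2].
have k1 : a ++ al = r1 ++ ka by move: h1; rewrite -!catA => /cat_cancell.
have k2 : be ++ r = ga ++ a0 by move: h2; rewrite e' !catA => /cat_cancelr.
have q1 : be ++ r ++ a ++ al = (ga ++ c) ++ c1 ++ al.
  by rewrite (catA r) catA h2 -!catA.
have q2 : be ++ r ++ a ++ al = (be ++ p1) ++ p ++ ka.
  by rewrite k1 (catA r) e -!catA.
rewrite q1.
have q3 : (ga ++ c) ++ (c1 ++ al) = (be ++ p1) ++ (p ++ ka) by rewrite -q1.
split.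
  move=> /(dots_bracket _ _ q3)[w [w' [-> ->]]].
  exists (w ++ ga ++ a0, a ++ al ++ w'); split.
    by apply/(dots_bracket _ _ e'); exists (w ++ ga), (al ++ w'); rewrite -!catA.
  apply/(dots_bracket _ _ e); exists (w ++ be), (ka ++ w').
  by rewrite -k2 (catA a) k1 -!catA.
move=> [y [d1 d2]].
have [u [v [u' [v' [-> -> e1 e2]]]]] := split_dots _ d1 d2.
have /prefixP[w' ew'] : prefix ((r ++ a) ++ al) (r ++ a ++ v).
  by rewrite -m1 {2}e2 !catA !prefix_prefix.
have /suffixP[w ew] : suffix (be ++ r ++ a) (u ++ a0 ++ a).
  by rewrite -m2 e' suffix_suffix catA e1 -catA suffix_suffix.
apply/(dots_bracket _ _ q3); exists w, w'.
have ev : v = al ++ w'.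
  by move: ew'; rewrite -!catA => /cat_cancell/cat_cancell.
have eu' : u' = w ++ be.
  by move: ew; rewrite catA e1 !catA => /cat_cancelr/cat_cancelr.
have eu : u = w ++ ga.
  apply: (@cat_cancelr _ a0); rewrite e1 eu' -!catA k2 //.
have ev' : v' = ka ++ w'.
  by apply: (@cat_cancell _ r1); rewrite -e2 ev !catA k1.
by rewrite ev eu' eu ev' -!catA.
Qed.

Lemma bracket_starE p q r : valid p q r ->
  valid (drop (size r) q) q (take (size q - size p) q).
Proof. by move=> _; rewrite /valid prefix_take suffix_drop. Qed.

Lemma dots_star s x y : dots (SP_star s) x y <-> dots s y x.
Proof.
case: (SP_cases s) => [->//|[r [r1 [p1 [p [e es]]]]]]; subst s.
rewrite (dots_bracket _ _ e).
have -> : SP_star (bracket p (r ++ r1) r) = bracket r1 (p1 ++ p) p1.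
  have [s' -> es'] := bracket_val (valid_cat e).
  by rewrite /SP_star es' drop_size_cat // e size_cat addnK take_size_cat.
have e' : p1 ++ p = r ++ r1 by [].
rewrite (dots_bracket _ _ e').
by split=> -[u [v [-> ->]]]; exists u, v.
Qed.

Lemma dots1 x y : dots SP_one x y <-> x = y.
Proof.
rewrite /SP_one (dots_bracket (r := [::]) (r1 := [::]) (p1 := [::]) (p := [::])) //.
case: x y => x1 x2 [y1 y2]; split=> [[u [v []]]|[-> ->]].
  by rewrite !cats0 => -> ->.
by exists y1, y2; rewrite !cats0.
Qed.

Lemma dots_fun s x y y' : dots s x y -> dots s x y' -> y = y'.
Proof.
case: (SP_cases s) => [->//|[r [r1 [p1 [p [e ->]]]]]].
move=> /(dots_bracket _ _ e)[u [v [-> ->]]].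
by move=> /(dots_bracket _ _ e)[u' [v' [[/cat_cancelr -> /cat_cancell ->] ->]]].
Qed.

Lemma dots_cofun s x x' y : dots s x y -> dots s x' y -> x = x'.
Proof. by move=> /dots_star h /dots_star; exact: dots_fun. Qed.

Lemma dots_idem s x y : SP_mul s s = s -> dots s x y -> x = y.
Proof.
move=> ss d; move: (d); rewrite -ss => /dots_mul[z [d1 d2]].
by rewrite (dots_fun d1 d) in d2; exact: dots_cofun d d2.
Qed.

Lemma SP_mulA : associative SP_mul.
Proof.
move=> s t u; apply: dots_inj => x y; rewrite !dots_mul; split.
  move=> [z [/dots_mul[w [d1 d2]] d3]]; exists w; split=> //.
  by apply/dots_mul; exists z.
move=> [z [d1 /dots_mul[w [d2 d3]]]]; exists w; split=> //.
by apply/dots_mul; exists z.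
Qed.

Lemma SP_mul1s : left_id SP_one SP_mul.
Proof.
move=> s; apply: dots_inj => x y; rewrite dots_mul; split.
  by move=> [z [d /dots1 <-]].
by move=> d; exists y; split=> //; apply/dots1.
Qed.

Lemma SP_muls1 : right_id SP_one SP_mul.
Proof.
move=> s; apply: dots_inj => x y; rewrite dots_mul; split.
  by move=> [z [/dots1 <- d]].
by move=> d; exists x; split=> //; apply/dots1.
Qed.

Lemma SP_mul0s : left_zero None SP_mul. Proof. by []. Qed.

Lemma SP_muls0 : right_zero None SP_mul. Proof. by case. Qed.

Lemma SP_mulsVs s : SP_mul (SP_mul s (SP_star s)) s = s.
Proof.
apply: dots_inj => x y; rewrite dots_mul; split.
  move=> [z [d1 /dots_mul[w [/dots_star d2 d3]]]].
  by have xw := dots_cofun d1 d2; subst w.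
move=> d; exists y; split=> //; apply/dots_mul; exists x; split=> //.
exact/dots_star.
Qed.

Lemma SP_mulVsV s : SP_mul (SP_mul (SP_star s) s) (SP_star s) = SP_star s.
Proof.
apply: dots_inj => x y; rewrite dots_mul; split.
  move=> [z [/dots_star d1 /dots_mul[w [d2 d3]]]].
  by have xw := dots_fun d1 d2; subst w.
move=> d; exists y; split=> //; apply/dots_mul; exists x; split=> //.
exact/dots_star.
Qed.

Lemma SP_idem_comm e f :
  SP_mul e e = e -> SP_mul f f = f -> SP_mul e f = SP_mul f e.
Proof.
have comm s t x y : SP_mul s s = s -> SP_mul t t = t ->
    dots (SP_mul s t) x y -> dots (SP_mul t s) x y.
  move=> ss tt /dots_mul[z [d1 d2]]; apply/dots_mul; exists z.
  have e1 := dots_idem tt d1; have e2 := dots_idem ss d2.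
  by subst x y.
by move=> ee ff; apply: dots_inj => x y; split; exact: comm.
Qed.

Definition SP_monoid : invMonoid := InvMonoid SP_mulA SP_mul1s SP_muls1
  SP_mul0s SP_muls0 SP_mulsVs SP_mulVsV SP_idem_comm.

End FreeMonoidInverseMonoid.

Lemma continuous_coord (T : topologicalType) (I : Type)
    (K : I -> topologicalType) (f : T -> prod_topology K) :
  (forall i, continuous (fun x => f x i)) -> continuous f.
Proof.
move=> h x; apply/cvg_sup => i; move: x.
apply/(@continuousP _ (initial_topology (@^~ i))) => _ [C oC <-].
exact: (open_comp (fun y _ => h i y) oC).
Qed.

Lemma continuous_pair (T U V : topologicalType) (f : T -> U) (g : T -> V) :
  continuous f -> continuous g -> continuous (fun x => (f x, g x)).
Proof. by move=> fc gc x; apply: cvg_pair; [exact: fc|exact: gc]. Qed.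

Section Shift.
Variable X : finType.

Definition XN : topologicalType :=
  prod_topology (fun _ : nat => discrete_topology X).

Definition scons (a : X) (x : XN) : XN := fun n => if n is m.+1 then x m else a.
Definition sbehead (x : XN) : XN := fun n => x n.+1.

(* (x, y) is the bi-infinite sequence ... x_1 x_0 . y_0 y_1 ... *)
Definition biseq : topologicalType := (XN * XN)%type.

Definition sigma (z : biseq) : biseq := (scons (z.2 0) z.1, sbehead z.2).
Definition sigma_inv (z : biseq) : biseq := (sbehead z.1, scons (z.1 0) z.2).

Lemma sbeheadK (x : XN) : scons (x 0) (sbehead x) = x.
Proof. by apply: funext => -[]. Qed.

Lemma sigmaK : cancel sigma sigma_inv.
Proof. by case=> x y; rewrite /sigma_inv /= sbeheadK. Qed.

Lemma sigma_invK : cancel sigma_inv sigma.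
Proof. by case=> x y; rewrite /sigma /= sbeheadK. Qed.

Lemma XN_coord_continuous n : continuous (fun x : XN => x n).
Proof. exact: (@proj_continuous _ (fun _ : nat => discrete_topology X) n). Qed.

Lemma biseq_fst_continuous n : continuous (fun z : biseq => z.1 n).
Proof.
move=> z; apply: (@continuous_comp _ _ _ fst (fun x : XN => x n)).
  exact: cvg_fst.
exact: XN_coord_continuous.
Qed.

Lemma biseq_snd_continuous n : continuous (fun z : biseq => z.2 n).
Proof.
move=> z; apply: (@continuous_comp _ _ _ snd (fun x : XN => x n)).
  exact: cvg_snd.
exact: XN_coord_continuous.
Qed.

Lemma sigma_continuous : continuous sigma.
Proof.
have h1 : continuous (fun z : biseq => scons (z.2 0) z.1).
  apply: continuous_coord => -[|n]; first exact: biseq_snd_continuous.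
  exact: biseq_fst_continuous.
have h2 : continuous (fun z : biseq => sbehead z.2).
  by apply: continuous_coord => n; exact: biseq_snd_continuous.
exact: continuous_pair h1 h2.
Qed.

Lemma sigma_inv_continuous : continuous sigma_inv.
Proof.
have h1 : continuous (fun z : biseq => sbehead z.1).
  by apply: continuous_coord => n; exact: biseq_fst_continuous.
have h2 : continuous (fun z : biseq => scons (z.1 0) z.2).
  apply: continuous_coord => -[|n]; first exact: biseq_fst_continuous.
  exact: biseq_snd_continuous.
exact: continuous_pair h1 h2.
Qed.

Definition sigma_pow (n : int) : biseq -> biseq :=
  match n with
  | Posz k => iter k sigma
  | Negz k => iter k.+1 sigma_inv
  end.

Local Open Scope ring_scope.

Lemma sigma_powS n z : sigma_pow (1 + n) z = sigma (sigma_pow n z).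
Proof.
case: n => [k|k]; first by rewrite -PoszD.
have -> : 1 + Negz k = - k%:Z.
  by rewrite NegzE -addn1 PoszD opprD addrCA subrr addr0.
case: k => [|k]; first exact: (esym (sigma_invK z)).
by rewrite -NegzE; exact: (esym (sigma_invK (sigma_pow (Negz k) z))).
Qed.

Lemma sigma_powP n z : sigma_pow (- 1 + n) z = sigma_inv (sigma_pow n z).
Proof.
by rewrite -[in RHS](addKr (- 1) n) opprK sigma_powS sigmaK.
Qed.

Lemma sigma_powD m n z : sigma_pow (m + n) z = sigma_pow m (sigma_pow n z).
Proof.
elim: m z => [z|k IH z|k IH z]; first by rewrite add0r.
  by rewrite -addn1 addnC PoszD -addrA !sigma_powS IH.
by rewrite -addn1 addnC PoszD opprD -addrA !sigma_powP IH.
Qed.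

Lemma iter_continuous (T : topologicalType) (f : T -> T) k :
  continuous f -> continuous (iter k f).
Proof.
move=> fc; elim: k => [|k IH] x; first exact: cvg_id.
by apply: continuous_comp; [exact: IH|exact: fc].
Qed.

Lemma sigma_pow_continuous n : continuous (sigma_pow n).
Proof.
case: n => k; apply: iter_continuous.
  exact: sigma_continuous.
exact: sigma_inv_continuous.
Qed.

Definition shift_action : intAction biseq :=
  @IntAction _ sigma_pow (fun => erefl) sigma_powD sigma_pow_continuous.

End Shift.

Local Open Scope ring_scope.
Local Open Scope complex_scope.

(* Unital C*-algebras over the complex numbers [R[i]].  [GRing.Algebra] makes
   them nonzero, which does not affect universal properties: into the zero
   algebra there is always exactly one map. *)
HB.mixin Record isCstarAlgebra (R : realType) A of GRing.Algebra R[i] A := {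
  star : A -> A;
  starD : {morph star : x y / x + y};
  starZ : forall (a : R[i]) (x : A), star (a *: x) = conjc a *: star x;
  starM : forall x y : A, star (x * y) = star y * star x;
  starK : involutive star;
  cnorm : A -> R;
  cnorm0_eq0 : forall x : A, cnorm x = 0 -> x = 0;
  cnormD : forall x y : A, cnorm (x + y) <= cnorm x + cnorm y;
  cnormZ : forall (a : R[i]) (x : A), cnorm (a *: x) = complex.Re `|a| * cnorm x;
  cnormM : forall x y : A, cnorm (x * y) <= cnorm x * cnorm y;
  cnorm_star : forall x : A, cnorm (star x * x) = cnorm x ^+ 2;
  cnorm_complete : forall u : nat -> A,
    (forall e : R, 0 < e -> exists N, forall m n, (N <= m)%N -> (N <= n)%N ->
       cnorm (u m - u n) < e) ->
    exists l : A, forall e : R, 0 < e -> exists N, forall n, (N <= n)%N ->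
       cnorm (u n - l) < e
}.

#[short(type="cstarAlgType")]
HB.structure Definition CstarAlgebra (R : realType) :=
  {A of GRing.Algebra R[i] A & isCstarAlgebra R A}.

Section CstarMorphisms.
Variable R : realType.
Implicit Types A B : cstarAlgType R.

Record is_star_hom A B (phi : A -> B) : Prop := IsStarHom {
  star_homD : {morph phi : x y / x + y};
  star_homZ : forall (a : R[i]) x, phi (a *: x) = a *: phi x;
  star_homM : {morph phi : x y / x * y};
  star_hom1 : phi 1 = 1;
  star_hom_star : forall x, phi (star x) = star (phi x)
}.

Definition cstar_iso A B : Prop :=
  exists phi : A -> B, is_star_hom phi /\ bijective phi.

(* The join of two commuting projections [p], [q] is [p + q - p q]. *)
Definition proj_join A (ps : seq A) : A :=
  foldr (fun p q => p + q - p * q) 0 ps.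
End CstarMorphisms.

Section TightRepresentations.
Variables (R : realType) (S : invMonoid).

Definition is_cover (e : idem S) (C : seq (idem S)) : Prop :=
  (forall c, c \in C -> idem_le (val c) (val e)) /\
  forall f : idem S, val f <> izero S -> idem_le (val f) (val e) ->
    exists2 c, c \in C & (val c ** val f)%im <> izero S.

Record is_tight_rep (B : cstarAlgType R) (pi : S -> B) : Prop := IsTightRep {
  tight_repM : forall s t : S, pi (s ** t)%im = pi s * pi t;
  tight_rep_star : forall s : S, pi (istar s) = star (pi s);
  tight_rep0 : pi (izero S) = 0;
  tight_rep1 : pi (ione S) = 1;
  tight_rep_cover : forall (e : idem S) (C : seq (idem S)), is_cover e C ->
    proj_join [seq pi (val c) | c <- C] = pi (val e)
}.

Definition is_Cstar_tight (A : cstarAlgType R) (pi : S -> A) : Prop :=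
  is_tight_rep pi /\
  forall (B : cstarAlgType R) (rho : S -> B), is_tight_rep rho ->
    exists! phi : A -> B, is_star_hom phi /\ forall s, phi (pi s) = rho s.
End TightRepresentations.

Section ContinuousFunctions.
Variables (R : realType) (Y : topologicalType).

Definition CY : Type := continuousType Y (R[i]^o).
HB.instance Definition _ := Choice.on CY.

Implicit Types f g : CY.

Lemma CY_eq f g : (forall y, f y = g y) -> f = g.
Proof. by move=> h; apply/continuousEP. Qed.

Lemma conjc_continuous : continuous (conjc : R[i]^o -> R[i]^o).
Proof.
move=> x A [e e0 sA]; exists e => // t xt; apply: sA.
by rewrite /ball_ /= -[_ - _](rmorphB (@conjc R)) normcJ.
Qed.

Lemma CYD_continuous f g : continuous (fun y => f y + g y : R[i]^o).
Proof. by move=> y; apply: cvgD; exact: cts_fun. Qed.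
Lemma CYN_continuous f : continuous (fun y => - f y : R[i]^o).
Proof. by move=> y; apply: cvgN; exact: cts_fun. Qed.
Lemma CYM_continuous f g : continuous (fun y => f y * g y : R[i]^o).
Proof. by move=> y; apply: cvgM; exact: cts_fun. Qed.
Lemma CYZ_continuous (a : R[i]) f : continuous (fun y => a * f y : R[i]^o).
Proof. by move=> y; apply: cvgM; [exact: cvg_cst|exact: cts_fun]. Qed.
Lemma CY_conj_continuous f : continuous (fun y => conjc (f y) : R[i]^o).
Proof.
by move=> y; apply: continuous_comp; [exact: cts_fun|exact: conjc_continuous].
Qed.

Definition CY_add f g : CY := mkcts (@CYD_continuous f g).
Definition CY_opp f : CY := mkcts (@CYN_continuous f).
Definition CY_mul f g : CY := mkcts (@CYM_continuous f g).
Definition CY_scale (a : R[i]) f : CY := mkcts (@CYZ_continuous a f).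
Definition CY_conj f : CY := mkcts (@CY_conj_continuous f).

Lemma CY_addA : associative CY_add.
Proof. by move=> f g h; apply: CY_eq => y; exact: addrA. Qed.

Lemma CY_addC : commutative CY_add.
Proof. by move=> f g; apply: CY_eq => y; exact: addrC. Qed.

Lemma CY_add0 : left_id (cst 0 : CY) CY_add.
Proof. by move=> f; apply: CY_eq => y; exact: add0r. Qed.

Lemma CY_addN : left_inverse (cst 0 : CY) CY_opp CY_add.
Proof. by move=> f; apply: CY_eq => y; exact: addNr. Qed.

HB.instance Definition _ :=
  GRing.isZmodule.Build CY CY_addA CY_addC CY_add0 CY_addN.

Lemma CY_mulA : associative CY_mul.
Proof. by move=> f g h; apply: CY_eq => y; exact: mulrA. Qed.

Lemma CY_mul1 : left_id (cst 1 : CY) CY_mul.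
Proof. by move=> f; apply: CY_eq => y; exact: mul1r. Qed.

Lemma CY_mulr1 : right_id (cst 1 : CY) CY_mul.
Proof. by move=> f; apply: CY_eq => y; exact: mulr1. Qed.

Lemma CY_mulDl : left_distributive CY_mul +%R.
Proof. by move=> f g h; apply: CY_eq => y; exact: mulrDl. Qed.

Lemma CY_mulDr : right_distributive CY_mul +%R.
Proof. by move=> f g h; apply: CY_eq => y; exact: mulrDr. Qed.

HB.instance Definition _ := GRing.Zmodule_isPzRing.Build CY
  CY_mulA CY_mul1 CY_mulr1 CY_mulDl CY_mulDr.

Lemma CY_scaleA : forall a b f, CY_scale a (CY_scale b f) = CY_scale (a * b) f.
Proof. by move=> a b f; apply: CY_eq => y; exact: mulrA. Qed.

Lemma CY_scale1 : left_id 1 CY_scale.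
Proof. by move=> f; apply: CY_eq => y; exact: mul1r. Qed.

Lemma CY_scaleDr : right_distributive CY_scale +%R.
Proof. by move=> a f g; apply: CY_eq => y; exact: mulrDr. Qed.

Lemma CY_scaleDl : forall f, {morph CY_scale^~ f : a b / a + b}.
Proof. by move=> f a b; apply: CY_eq => y; exact: mulrDl. Qed.

HB.instance Definition _ := GRing.Zmodule_isLmodule.Build R[i] CY
  CY_scaleA CY_scale1 CY_scaleDr CY_scaleDl.

End ContinuousFunctions.

Section CrossedProduct.
Variables (R : realType) (Y : topologicalType) (theta : intAction Y).

Lemma CY_act_continuous n (f : CY R Y) :
  continuous (fun y => f (theta (- n) y) : R[i]^o).
Proof.
move=> y; apply: (@continuous_comp _ _ _ (theta (- n)) f).
  exact: iact_continuous.
exact: cts_fun.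
Qed.

Definition CY_act (n : int) (f : CY R Y) : CY R Y :=
  mkcts (@CY_act_continuous n f).

Record is_covariant_rep (B : cstarAlgType R) (rho : CY R Y -> B) (U : int -> B)
    : Prop := IsCovariantRep {
  covD : {morph rho : f g / f + g};
  covZ : forall (a : R[i]) f, rho (a *: f) = a *: rho f;
  covM : {morph rho : f g / f * g};
  cov1 : rho 1 = 1;
  cov_star : forall f, rho (CY_conj f) = star (rho f);
  covU0 : U 0 = 1;
  covUD : {morph U : m n / m + n >-> m * n};
  covU_star : forall n, star (U n) = U (- n);
  cov_conj : forall n f, U n * rho f * star (U n) = rho (CY_act n f)
}.

(* The full crossed product is the universal C*-algebra for covariant
   representations; the integers being discrete and [C(Y)] unital (for compact
   [Y]), it is unital and generated by [rho] and [U]. *)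
Definition is_crossed_product (A : cstarAlgType R) (rho : CY R Y -> A)
    (U : int -> A) : Prop :=
  is_covariant_rep rho U /\
  forall (B : cstarAlgType R) (rho' : CY R Y -> B) (U' : int -> B),
    is_covariant_rep rho' U' ->
    exists! phi : A -> B, [/\ is_star_hom phi,
      forall f, phi (rho f) = rho' f & forall n, phi (U n) = U' n].
End CrossedProduct.

(* Main.v *)
(** Sending a pair z of infinite words to the set of idempotents [q, rq, r]
whose word, dotted after r, can be read around the dot of z is a homeomorphism
from the pairs onto the tight spectrum: a filter is contained in one of these
sets by compactness, and each of them is an ultrafilter.  An element [p, q, r]
acts as a power of the shift on such pairs, its degree, and two elements defined
at z have the same germ at z exactly when their degrees agree, because then they
agree below the idempotent of a large enough window around the dot.

For the algebras, s |-> U^(deg s) 1_(Dom s) turns a covariant representation into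
a tight one.  Conversely, a tight representation gives the unitary
u = sum_a pi[e, a, e], which implements the shift, and a *-homomorphism on
continuous functions, the limit of sampling a function on cylinders.  A unital
*-homomorphism F on continuous functions is automatically bounded, since a real f
with |f| <= 1 is the real part of the unitary f + i sqrt(1 - f^2); hence it is
determined by its values on cylinders, and the two constructions are inverse to
each other on the universal algebras. *)
Require Import Defs.
From mathcomp Require Import all_boot all_order all_algebra.
From mathcomp Require Import all_classical all_reals all_analysis.
From mathcomp Require Import complex finmap zify lra.

Set Implicit Arguments.
Unset Strict Implicit.
Unset Printing Implicit Defensive.
Import Order.TTheory GRing.Theory Num.Theory.
Import numFieldNormedType.Exports.

(** * Dotted words and the shift *)

Section Words.
Variable X : finType.
Implicit Types (u v p q r : seq X) (z w : biseq X) (s t : SP X).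
Implicit Types x y : seq X * seq X.
Local Open Scope ring_scope.

Fixpoint starts v (x : XN X) : bool :=
  if v is a :: v' then (x 0%N == a) && starts v' (sbehead x) else true.

(* [z] reads [u.v] around its dot. *)
Definition cyl u v z : bool := starts (rev u) z.1 && starts v z.2.

(** The left half of a sequence is indexed outwards from the dot, so its letters are reversed to be
    read from left to right. *)
Definition lword z k : seq X := rev (mkseq z.1 k).
Definition rword z l : seq X := mkseq z.2 l.

Lemma starts_mkseq v (x : XN X) : starts v x = (mkseq x (size v) == v).
Proof.
elim: v x => //= a v IH x; rewrite IH /mkseq /= eqseq_cons; congr (_ && _).
by rewrite (iotaDl 1) -map_comp.
Qed.

Lemma starts_cat v v' (x : XN X) : starts (v ++ v') x -> starts v x.
Proof. by elim: v x => //= a v IH x /andP[-> /IH]. Qed.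

Lemma size_lword z k : size (lword z k) = k.
Proof. by rewrite size_rev size_mkseq. Qed.

Lemma size_rword z l : size (rword z l) = l.
Proof. exact: size_mkseq. Qed.

Lemma cyl_trunc z k l : cyl (lword z k) (rword z l) z.
Proof. by rewrite /cyl !starts_mkseq revK !size_mkseq !eqxx. Qed.

Lemma cyl_cat u u' v v' z : cyl (u' ++ u) (v ++ v') z -> cyl u v z.
Proof. by rewrite /cyl rev_cat => /andP[/starts_cat -> /starts_cat ->]. Qed.

Lemma cyl_inj u v u' v' z : size u = size u' -> size v = size v' ->
  cyl u v z -> cyl u' v' z -> u = u' /\ v = v'.
Proof.
rewrite /cyl !starts_mkseq !size_rev => -> -> /andP[/eqP e1 /eqP e2].
by rewrite e1 e2 => /andP[/eqP/(can_inj revK) -> /eqP ->].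
Qed.

Lemma cyl_eq u v k l z w : cyl u v w -> size u = k -> size v = l ->
  (forall i, (i < k)%N -> z.1 i = w.1 i) ->
  (forall i, (i < l)%N -> z.2 i = w.2 i) -> cyl u v z.
Proof.
move=> + hu hv h1 h2; rewrite /cyl !starts_mkseq size_rev hu hv.
rewrite /mkseq (@eq_in_map _ _ w.1 z.1 (iota 0 k)).1; last first.
  by move=> i; rewrite mem_iota => /h1.
by rewrite (@eq_in_map _ _ w.2 z.2 (iota 0 l)).1 // => i; rewrite mem_iota => /h2.
Qed.

Lemma cyl_agree u v k l z w : cyl u v z -> cyl u v w ->
  (k <= size u)%N -> (l <= size v)%N ->
  (forall i, (i < k)%N -> z.1 i = w.1 i) /\
  (forall i, (i < l)%N -> z.2 i = w.2 i).
Proof.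
rewrite /cyl !starts_mkseq !size_rev => /andP[/eqP e1 /eqP e2].
move=> /andP[/eqP e3 /eqP e4] ku lv; split=> i hi.
  by have := congr1 (nth (z.1 0%N) ^~ i) (etrans e1 (esym e3));
    rewrite !nth_mkseq //; apply: leq_trans ku.
by have := congr1 (nth (z.1 0%N) ^~ i) (etrans e2 (esym e4));
  rewrite !nth_mkseq //; apply: leq_trans lv.
Qed.

Lemma cyl_consr u a v z : cyl u (a :: v) z = cyl (rcons u a) v (sigma z).
Proof. by rewrite /cyl rev_rcons /= andbCA andbA. Qed.

Lemma cyl_sigma_iter u v' v z :
  cyl u (v' ++ v) z = cyl (u ++ v') v (iter (size v') (@sigma X) z).
Proof.
elim: v' u z => [|a v' IH] u z; first by rewrite cats0.
by rewrite iterSr cyl_consr IH cat_rcons.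
Qed.

Lemma sigma_pow_nat (n : nat) z : sigma_pow n%:Z z = iter n (@sigma X) z.
Proof. by []. Qed.

Lemma sigma_pow0 z : sigma_pow 0 z = z.
Proof. by []. Qed.

(** Both sides describe the same letters with the dot at two places, and each application of [sigma]
    carries the dot past one letter. *)
Lemma cyl_shift u v u' v' z : u ++ v = u' ++ v' ->
  cyl u v z = cyl u' v' (sigma_pow ((size u')%:Z - (size u)%:Z) z).
Proof.
(* Moving the dot to the left is the inverse of moving it to the right, so only the latter is
   treated. *)
wlog le : u v u' v' z / (size u <= size u')%N => [h e|].
  have [le|/ltnW le] := leqP (size u) (size u'); first exact: h.
  rewrite [RHS](h u' v' u v) // -sigma_powD; congr (cyl _ _ _).
  by rewrite addrC subrKA subrr sigma_pow0.
move=> e.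
have [w ew] : exists w : seq X, u' = u ++ w.
  exists (drop (size u) u'); rewrite -[LHS](cat_take_drop (size u)); congr (_ ++ _).
  by have := congr1 (take (size u)) e; rewrite take_size_cat // takel_cat.
have ev : v = w ++ v' by move: e; rewrite ew -catA => /cat_cancell.
rewrite ev cyl_sigma_iter ew size_cat; congr (cyl _ _ _).
by rewrite PoszD addrC addKr -sigma_pow_nat.
Qed.

Definition Dom s z : bool :=
  if s is Some s' then
    let: (p, q, r) := val s' in cyl r (drop (size r) q) z
  else false.

(** With q = p1 p this is |p1| - |r|, the number of places by which [p, q, r] moves the dot to the
    right. The zero element gets the default 0, so additivity is claimed for nonzero products
    only. *)
Definition deg s : int :=
  if s is Some s' then
    let: (p, q, r) := val s' in (size q)%:Z - (size p)%:Z - (size r)%:Z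
  else 0.

(** The letters within this distance of the dot decide whether [s] applies. *)
Definition rank s : nat :=
  if s is Some s' then size (val s').1.2 else 0%N.

Lemma Dom_bracket r r1 p1 p z : r ++ r1 = p1 ++ p ->
  Dom (bracket p (r ++ r1) r) z = cyl r r1 z.
Proof.
by move=> /valid_cat/bracket_val[s' -> e]; rewrite /Dom e drop_size_cat.
Qed.

Lemma deg_bracket r r1 p1 p : r ++ r1 = p1 ++ p ->
  deg (bracket p (r ++ r1) r) = (size p1)%:Z - (size r)%:Z.
Proof.
move=> e; have [s' -> e'] := bracket_val (valid_cat e); rewrite /deg e' e size_cat.
by rewrite PoszD addrK.
Qed.

Lemma rank_bracket r r1 p1 p : r ++ r1 = p1 ++ p ->
  rank (bracket p (r ++ r1) r) = (size r + size r1)%N.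
Proof.
by move=> e; have [s' -> e'] := bracket_val (valid_cat e); rewrite /rank e' size_cat.
Qed.

Lemma dots_cat s x y : dots s x y -> x.1 ++ x.2 = y.1 ++ y.2 /\
  (size y.1)%:Z = (size x.1)%:Z + deg s.
Proof.
case: (SP_cases s) => [->//|[r [r1 [p1 [p [e ->]]]]]].
move=> /(dots_bracket _ _ e)[u [v [-> ->]]] /=; rewrite (deg_bracket e).
split; first by rewrite -!catA (catA r) e -!catA.
by rewrite !size_cat !PoszD -addrA subrKC.
Qed.

Lemma dots_Dom s x y z : dots s x y -> cyl x.1 x.2 z -> Dom s z.
Proof.
case: (SP_cases s) => [->//|[r [r1 [p1 [p [e ->]]]]]].
move=> /(dots_bracket _ _ e)[u [v [-> _]]] /=; rewrite (Dom_bracket _ e).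
exact: cyl_cat.
Qed.

Lemma dots_cyl s x y z : dots s x y ->
  cyl x.1 x.2 z = cyl y.1 y.2 (sigma_pow (deg s) z).
Proof.
move=> /dots_cat[e1 e2]; rewrite (cyl_shift _ e1); congr (cyl _ _ (sigma_pow _ _)).
by rewrite e2 addrC addKr.
Qed.

(** On a window of at least [rank s] letters on each side, [s] already acts on the finite dotted
    word. Each side loses at most [rank s] letters, which leaves room to apply a second element. *)
Lemma Dom_dots s x z : Dom s z -> cyl x.1 x.2 z ->
  (rank s <= size x.1)%N -> (rank s <= size x.2)%N ->
  exists y, [/\ dots s x y, (size x.1 - rank s <= size y.1)%N &
    (size x.2 - rank s <= size y.2)%N].
Proof.
case: (SP_cases s) => [->//|[r [r1 [p1 [p [e ->]]]]]].
rewrite (Dom_bracket _ e) (rank_bracket e); case: x => x1 x2 /= d c le1 le2.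
have hr : (size r <= size x1)%N by lia.
have hr1 : (size r1 <= size x2)%N by lia.
pose u := take (size x1 - size r) x1; pose r' := drop (size x1 - size r) x1.
pose r1' := take (size r1) x2; pose v := drop (size r1) x2.
have ex1 : x1 = u ++ r' by rewrite cat_take_drop.
have ex2 : x2 = r1' ++ v by rewrite cat_take_drop.
have [er er1] : r' = r /\ r1' = r1.
  apply: (@cyl_inj _ _ _ _ z) => //.
  - by rewrite size_drop subKn.
  - by rewrite size_takel.
  - by apply: (@cyl_cat _ u _ v); rewrite -ex1 -ex2.
exists (u ++ p1, p ++ v); split.
- by apply/(dots_bracket _ _ e); exists u, v; rewrite ex1 ex2 er er1.
- rewrite /= !size_cat size_takel; lia.
- rewrite /= !size_cat size_drop; lia.
Qed.

(** A large finite window around the dot reduces this to [dots_mul], the composition of the partial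
    injections on finite dotted words. *)
Lemma Dom_mul s t z :
  Dom (SP_mul s t) z = Dom t z && Dom s (sigma_pow (deg t) z).
Proof.
apply/idP/andP => [d|[d1 d2]].
  pose k := rank (SP_mul s t); have c := cyl_trunc z k k.
  have [||y [/dots_mul[y' [h1 h2]] _ _]] := @Dom_dots _ (_, _) _ d c.
  - by rewrite /= size_lword.
  - by rewrite /= size_rword.
  split; first exact: (dots_Dom h1 c).
  by apply: dots_Dom h2 _; rewrite -(dots_cyl _ h1).
(* Applying [t] uses up at most [rank t] letters on each side and leaves [rank s] of them for
   [s]. *)
pose k := (rank s + rank t)%N; have c := cyl_trunc z k k.
have [||y [h1 le1 le2]] := @Dom_dots _ (_, _) _ d1 c.
- by rewrite /= size_lword leq_addl.
- by rewrite /= size_rword leq_addl.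
have [|||y' [h2 _ _]] := @Dom_dots _ y _ d2.
- by rewrite -(dots_cyl _ h1).
- by apply: leq_trans le1; rewrite size_lword addnK.
- by apply: leq_trans le2; rewrite size_rword addnK.
by apply: (@dots_Dom _ (_, _) y' _ _ c); apply/dots_mul; exists y.
Qed.

Lemma SP_dots s : s <> None -> exists x y, dots s x y.
Proof.
case: (SP_cases s) => [->//|[r [r1 [p1 [p [e ->]]]]]] _.
by do 2 eexists; exact: dots_min e.
Qed.

(** A nonzero product acts on some dotted word, and the length left of the dot records both
    displacements. *)
Lemma deg_mul s t : SP_mul s t <> None -> deg (SP_mul s t) = deg s + deg t.
Proof.
move=> /SP_dots[x [y d]]; have [_ e] := dots_cat d.
move: d => /dots_mul[w [/dots_cat[_ e1] /dots_cat[_ e2]]].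
by apply: (@addrI _ (size x.1)%:Z); rewrite -e e2 e1 -addrA (addrC (deg s)).
Qed.

Lemma Dom_star s z : Dom (SP_star s) z = Dom s (sigma_pow (- deg s) z).
Proof.
case: (SP_cases s) => [->//|[r [r1 [p1 [p [e es]]]]]].
rewrite es (Dom_bracket _ e) (deg_bracket e) (cyl_shift _ e) -sigma_powD subrr.
have -> : SP_star (bracket p (r ++ r1) r) = bracket r1 (p1 ++ p) p1.
  have [s' -> es'] := bracket_val (valid_cat e).
  by rewrite /SP_star es' drop_size_cat // e size_cat addnK take_size_cat.
exact: (Dom_bracket _ (esym e)).
Qed.

Lemma deg_star s : deg (SP_star s) = - deg s.
Proof.
case: (SP_cases s) => [->|[r [r1 [p1 [p [e es]]]]]]; first by rewrite /deg oppr0.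
rewrite es (deg_bracket e) opprB.
have -> : SP_star (bracket p (r ++ r1) r) = bracket r1 (p1 ++ p) p1.
  have [s' -> es'] := bracket_val (valid_cat e).
  by rewrite /SP_star es' drop_size_cat // e size_cat addnK take_size_cat.
by rewrite (deg_bracket (esym e)).
Qed.

Lemma deg_idem s : SP_mul s s = s -> deg s = 0.
Proof.
move=> ss; case: (pselect (s = None)) => [->//|nz].
have := @deg_mul s s; rewrite ss => /(_ nz)/eqP.
by rewrite -subr_eq0 opprD addrA subrr sub0r oppr_eq0 => /eqP.
Qed.

(** An element that does not displace the dot acts as a partial identity; with [deg_idem], the
    idempotents are exactly the elements of degree 0. *)
Lemma deg0_idem s : deg s = 0 -> SP_mul s s = s.
Proof.
move=> d0.
have h x y : dots s x y -> x = y.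
  move=> /dots_cat[]; rewrite d0 addr0 => + [e2].
  case: x y e2 => x1 x2 [y1 y2] /= e2 /eqP.
  by rewrite eqseq_cat // => /andP[/eqP -> /eqP ->].
apply: dots_inj => x y; rewrite dots_mul; split.
  by move=> [w [h1 h2]]; move: (h _ _ h1) (h _ _ h2) => ? ?; subst.
by move=> d; exists x; have exy := h _ _ d; subst y.
Qed.

Definition cyl_elt u v : SP X := bracket v (u ++ v) u.

Lemma Dom_cyl_elt u v z : Dom (cyl_elt u v) z = cyl u v z.
Proof. exact: Dom_bracket. Qed.

Lemma deg_cyl_elt u v : deg (cyl_elt u v) = 0.
Proof. by rewrite (deg_bracket (p1 := u)) // subrr. Qed.

Lemma dots_cyl_elt u v x y : dots (cyl_elt u v) x y <->
  x = y /\ exists u' v', x = (u' ++ u, v ++ v').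
Proof.
rewrite (@dots_bracket X u v u v) //; split.
  by move=> [u' [v' [-> ->]]]; split=> //; exists u', v'.
by move=> [<- [u' [v' ->]]]; exists u', v'.
Qed.

Lemma cyl_elt_nil : cyl_elt [::] [::] = SP_one X. Proof. by []. Qed.

Lemma cyl_elt_idem u v : SP_mul (cyl_elt u v) (cyl_elt u v) = cyl_elt u v.
Proof. by apply: deg0_idem; exact: deg_cyl_elt. Qed.

Lemma dots_mul_cyl_elt s u v x y : dots (SP_mul s (cyl_elt u v)) x y <->
  dots s x y /\ exists u' v', x = (u' ++ u, v ++ v').
Proof.
rewrite dots_mul; split; first by move=> [w [/dots_cyl_elt[<- h] d]].
by move=> [d h]; exists x; split=> //; apply/dots_cyl_elt.
Qed.

(* If [s] and [t] move the dot by the same amount and are both defined at [z],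
   then they agree on the bi-infinite words that agree with [z] on a large
   enough window. *)
Lemma mul_cyl_elt_germ s t u v z : Dom s z -> Dom t z -> deg s = deg t ->
  cyl u v z ->
  (rank s <= size u)%N -> (rank s <= size v)%N ->
  (rank t <= size u)%N -> (rank t <= size v)%N ->
  SP_mul s (cyl_elt u v) = SP_mul t (cyl_elt u v).
Proof.
move=> ds dt st c su sv tu tv.
have half s' t' : Dom s' z -> deg s' = deg t' -> Dom t' z ->
   (rank s' <= size u)%N -> (rank s' <= size v)%N ->
   (rank t' <= size u)%N -> (rank t' <= size v)%N ->
   forall x y, dots (SP_mul s' (cyl_elt u v)) x y -> dots (SP_mul t' (cyl_elt u v)) x y.
  move=> ds' st' dt' su' sv' tu' tv' x y /dots_mul_cyl_elt[d [u' [v' ex]]].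
  apply/dots_mul_cyl_elt; split; last by exists u', v'.
  have [||y' [d' _ _]] := @Dom_dots t' (u, v) z dt' c => //.
  (* Since [t'] applies to the window itself, it applies to every word extending it. Both images of
     [x] then have the same letters and the same dot, hence coincide. *)
  have d2 : dots t' x (u' ++ y'.1, y'.2 ++ v').
    move: d'; case: (SP_cases t') => [->//|[r [r1 [p1 [p [e ->]]]]]].
    move=> /(dots_bracket _ _ e)[a [b [[eu ev] ->]]].
    apply/(dots_bracket _ _ e); exists (u' ++ a), (b ++ v').
    by rewrite ex eu ev /= -!catA.
  suff -> : y = (u' ++ y'.1, y'.2 ++ v') by [].
  move: (dots_cat d) (dots_cat d2) => [e1 e2] [e3 e4].
  move: e2; rewrite st' -e4 => -[] es.
  move: e1; rewrite e3; case: y {d} es => y1 y2 es.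
  by move=> /esym/eqP; rewrite eqseq_cat // => /andP[/eqP /= -> /eqP /= ->].
by apply: dots_inj => x y; split; apply: half.
Qed.

(** An idempotent has the degree of the unit, so below a large window around [z] the two have the
    same germ. *)
Lemma cyl_elt_absorb s u v z : SP_mul s s = s -> Dom s z -> cyl u v z ->
  (rank s <= size u)%N -> (rank s <= size v)%N -> SP_mul (cyl_elt u v) s = cyl_elt u v.
Proof.
move=> ss ds c su sv; rewrite SP_idem_comm ?cyl_elt_idem //.
have r1 : rank (SP_one X) = 0%N by rewrite -cyl_elt_nil (rank_bracket (p1 := [::])).
rewrite (@mul_cyl_elt_germ _ (SP_one X) u v z) ?r1 ?SP_mul1s //.
  by rewrite -cyl_elt_nil Dom_cyl_elt.
by rewrite deg_idem // -cyl_elt_nil deg_cyl_elt.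
Qed.

Hypothesis X_nonempty : (0 < #|X|)%N.

Lemma exists_cyl u v : exists z, cyl u v z.
Proof.
have x0 : X by move: X_nonempty => /card_gt0P/sigW[x _].
(* Beyond the prescribed letters both halves continue with the default letter [x0]. *)
exists (nth x0 (rev u), nth x0 v); rewrite /cyl !starts_mkseq /=.
by rewrite !mkseq_nth !eqxx.
Qed.

Lemma Dom_nonempty s : s <> None -> exists z, Dom s z.
Proof.
case: (SP_cases s) => [->//|[r [r1 [p1 [p [e ->]]]]]] _.
by have [z h] := exists_cyl r r1; exists z; rewrite (Dom_bracket _ e).
Qed.

Lemma Dom_empty s : (forall z, ~~ Dom s z) -> s = None.
Proof. by move=> h; apply: contrapT => /Dom_nonempty[z]; apply/negP. Qed.

End Words.

(** * Topology of the space of bi-infinite sequences *)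

Section BiseqTopology.
Variable X : finType.
Implicit Types (z w : biseq X).
Local Open Scope classical_set_scope.

Definition agree n z w : Prop := forall i, (i < n)%N -> z.1 i = w.1 i /\ z.2 i = w.2 i.

(** The sets of sequences sharing an initial segment with [x] generate a filter [G]. Its convergence
    to [x] is checked in each coordinate, and coordinate [i] is constant on the set of index
    [i.+1]. *)
Lemma XN_nbhs (x : XN X) (U : set (XN X)) : nbhs x U ->
  exists n, forall y, (forall i, (i < n)%N -> x i = y i) -> U y.
Proof.
pose G : set_system (XN X) := filter_from [set: nat]
  (fun n => [set y : XN X | forall i, (i < n)%N -> x i = y i]).
have FG : Filter G.
  apply: filter_from_filter; first by exists 0%N.
  move=> m n _ _; exists (maxn m n) => // y h; split=> i hi; apply: h;
    by rewrite leq_max hi ?orbT.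
suff cG : G --> x by move=> /cG[n _ h]; exists n => y hy; apply: h.
apply/cvg_sup => i U'; rewrite nbhsE => -[B [[C oC eB] Bx] sB].
exists i.+1 => // y h; apply: sB; rewrite -eB /= /preimage /=.
have <- : x i = y i by apply: h.
by move: Bx; rewrite -eB.
Qed.

Lemma biseq_nbhs z (U : set (biseq X)) : nbhs z U ->
  exists n, forall w, agree n z w -> U w.
Proof.
move=> [[P Q] /= [/XN_nbhs[m hm] /XN_nbhs[n hn]] sU]; exists (maxn m n) => w h.
by apply: sU; split; [apply: hm|apply: hn] => i hi;
  case: (h i); rewrite ?leq_max ?hi ?orbT.
Qed.

Lemma agree_nbhs n z : nbhs z [set w | agree n z w].
Proof.
elim: n => [|n IH]; first by apply: filterE => w i; rewrite ltn0.
have n1 : nbhs z [set w : biseq X | w.1 n = z.1 n].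
  have := @biseq_fst_continuous X n z [set a | a = z.1 n]; apply.
  by rewrite nbhs_principalE; apply/principal_filterP.
have n2 : nbhs z [set w : biseq X | w.2 n = z.2 n].
  have := @biseq_snd_continuous X n z [set a | a = z.2 n]; apply.
  by rewrite nbhs_principalE; apply/principal_filterP.
apply: filterS (filterI IH (filterI n1 n2)) => w [h [h1 h2]] i.
by rewrite ltnS leq_eqVlt => /predU1P[->|/h].
Qed.

Lemma biseq_compact : compact [set: biseq X].
Proof.
have cX : compact [set: XN X].
  have cX1 : compact [set: discrete_topology X].
    by apply: finite_compact; exact: (@finite_finset X).
  have := @tychonoff nat (fun _ => discrete_topology X) (fun _ => setT) (fun=> cX1).
  by congr compact; apply/seteqP; split.
by rewrite -setXTT; apply: compact_setX.
Qed.

Lemma Dom_agree (s : SP X) n z w : (rank s <= n)%N -> agree n z w ->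
  Dom s z = Dom s w.
Proof.
case: (SP_cases s) => [->//|[r [r1 [p1 [p [e ->]]]]]].
rewrite !(Dom_bracket _ e) (rank_bracket e) => le h.
by apply/idP/idP => c; apply: (cyl_eq c (erefl _) (erefl _)) => i hi; case: (h i) => //; lia.
Qed.

Lemma Dom_continuous (s : SP X) : continuous (Dom s : biseq X -> bool).
Proof.
move=> z U; rewrite nbhs_principalE => /principal_filterP Uz.
by apply: filterS (agree_nbhs (rank s) z) => w /(Dom_agree (leqnn _)) h; rewrite /= -h.
Qed.

Lemma Dom_closed (s : SP X) : closed [set z | Dom s z].
Proof.
move=> z /(_ _ (agree_nbhs (rank s) z))[w [dw h]].
by rewrite /= (Dom_agree (leqnn _) h).
Qed.

Lemma agree_cyl k l n z w : (n <= k)%N -> (n <= l)%N ->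
  cyl (lword z k) (rword z l) w -> agree n z w.
Proof.
move=> nk nl c i hi; have [|//|h1 h2] := @cyl_agree X _ _ n n z w (cyl_trunc z k l) c.
- by rewrite size_lword.
- by rewrite size_rword.
by split; [apply: h1|apply: h2].
Qed.

Lemma biseq_eq z w : (forall n, agree n z w) -> z = w.
Proof.
case: z w => z1 z2 [w1 w2] h.
by congr pair; apply: funext => i; case: (h i.+1 i (ltnSn i)).
Qed.

End BiseqTopology.

(** * The tight groupoid *)

Section TightGroupoidShift.
Variable X : finType.
Hypothesis X_nonempty : (0 < #|X|)%N.
Local Notation S := (SP_monoid X).
Implicit Types (z w : biseq X) (s t : SP X).
Local Open Scope classical_set_scope.
Local Open Scope ring_scope.

Definition cyl_idem u v : idem S := @mkidem S (cyl_elt u v) (cyl_elt_idem u v).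

Lemma deg_val (e : idem S) : deg (val e) = 0.
Proof. exact: deg_idem (idemP e). Qed.

Lemma Dom_idem_mul (e f : idem S) z :
  Dom (SP_mul (val e) (val f)) z = Dom (val e) z && Dom (val f) z.
Proof. by rewrite Dom_mul deg_val sigma_pow0 andbC. Qed.

Definition Xi z : idem_subsets S := fun e : idem S => Dom (val e) z.

Lemma Xi_filter z : is_filter (Xi z).
Proof.
split.
- exists (cyl_idem [::] [::]); exact: (etrans (Dom_cyl_elt _ _ _)).
- by exists (@mkidem S None erefl).
- move=> e f; rewrite /idem_le /Xi => xe ef.
  by have := Dom_idem_mul e f z; rewrite [SP_mul _ _]ef xe /= => <-.
- by move=> e f xe xf; rewrite /Xi /= Dom_idem_mul; apply/andP.
Qed.

(** The domains of the members of [eta] generate a proper filter: a member with empty domain would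
    be zero and would put every idempotent into [eta]. By compactness this filter has a cluster
    point, which lies in all the domains because they are closed. *)
Lemma Xi_sub (eta : idem_subsets S) : is_filter eta ->
  exists z, forall e, eta e -> Xi z e.
Proof.
move=> heta; have [[e0 eta0] [e1 ne1] up mul] := heta.
pose F : set_system (biseq X) := filter_from [set e | eta e] (fun e => [set z | Xi z e]).
have FF : ProperFilter F.
  apply: filter_from_proper; last first.
    move=> e etae; apply: Dom_nonempty => // e_0.
    suff : eta e1 by rewrite (negbTE ne1).
    by apply: up etae _; rewrite /idem_le e_0.
  apply: filter_from_filter; first by exists e0.
  move=> e f he hf; exists (idem_mul e f); first exact: mul.
  by move=> z; rewrite /= /Xi /= Dom_idem_mul => /andP[].
have [|z [_ cz]] := @biseq_compact X F FF; first exact: filterT.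
exists z => e etae; apply: (@Dom_closed X (val e)) => B nB.
by apply: cz nB; exists e.
Qed.

(** The filter [eta] lies in some [Xi w]; then [w] reads every window of [z], so [w = z] and [eta]
    is squeezed between equal filters. *)
Lemma Xi_max z eta : is_filter eta -> (forall e, Xi z e -> eta e) -> eta = Xi z.
Proof.
move=> heta sub; have [w hw] := Xi_sub heta.
suff zw : z = w.
  by apply: funext => e; apply/idP/idP => [/hw|/sub //]; rewrite zw.
apply: biseq_eq => n; apply: (@agree_cyl _ n n) => //.
rewrite -Dom_cyl_elt; apply: (hw (cyl_idem _ _)); apply: sub.
by rewrite /Xi /= Dom_cyl_elt cyl_trunc.
Qed.

Lemma Xi_ultra z : is_ultrafilter (Xi z).
Proof. by split; [exact: Xi_filter|move=> eta heta; exact: Xi_max]. Qed.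

Lemma Xi_continuous : continuous (Xi : biseq X -> idem_subsets S).
Proof. by apply: continuous_coord => e; exact: Dom_continuous. Qed.

Lemma Xi_range_closed : closed (range Xi).
Proof.
apply: compact_closed.
  by apply: hausdorff_product => e; exact: discrete_hausdorff.
apply: continuous_compact; last exact: biseq_compact.
by apply: continuous_subspaceT; exact: Xi_continuous.
Qed.

(** Every ultrafilter is some [Xi z], and the range of [Xi] is closed, being a compact subset of a
    Hausdorff space; so the closure adds nothing. *)
Lemma tight_Xi xi : tight_filters xi <-> exists z, xi = Xi z.
Proof.
split=> [[_ cl]|[z ->]]; last first.
  by split; [exact: Xi_filter|apply: subset_closure; exact: Xi_ultra].
suff [z _ <-] : range Xi xi by exists z.
apply: Xi_range_closed; move: cl; apply: closure_subset => eta [feta meta].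
have [z hz] := Xi_sub feta; exists z => //; exact: meta (Xi_filter z) hz.
Qed.

Lemma Xi_inj : injective Xi.
Proof.
move=> z w e; apply: biseq_eq => n; apply: (@agree_cyl _ n n) => //.
by rewrite -Dom_cyl_elt -[Dom _ _]/(Xi w (cyl_idem _ _)) -e /Xi /= Dom_cyl_elt cyl_trunc.
Qed.

Definition spec z : tight_spectrum S :=
  SigSub (mem_set ((tight_Xi (Xi z)).2 (ex_intro _ z erefl))).

Lemma val_spec z : set_val (spec z) = Xi z. Proof. by []. Qed.

Lemma spec_ex (x : tight_spectrum S) : exists z, x = spec z.
Proof.
have /tight_Xi[z e] := spectrum_tight x; exists z; exact: spectrum_inj.
Qed.

Definition unspec (x : tight_spectrum S) : biseq X := projT1 (cid (spec_ex x)).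

Lemma unspecK : cancel unspec spec.
Proof. by move=> x; rewrite /unspec; case: cid. Qed.

Lemma spec_inj : injective spec.
Proof. by move=> z w /(congr1 set_val)/Xi_inj. Qed.

Lemma specK : cancel spec unspec.
Proof. by move=> z; apply: spec_inj; rewrite unspecK. Qed.

Lemma spec_continuous : continuous spec.
Proof.
apply/(@continuousP _ (initial_topology set_val)) => _ [C oC <-].
have : open (Xi @^-1` C) by apply: open_comp oC => z _; exact: Xi_continuous.
by [].
Qed.

Lemma spectrum_open (e : idem S) : open [set x : tight_spectrum S | set_val x e].
Proof.
exists [set xi : idem_subsets S | xi e] => //.
apply: (@open_comp _ _ (fun xi : idem_subsets S => xi e) [set b | b]).
  by move=> xi _; exact: (@proj_continuous _ (fun _ : idem S => bool) e).
exact: discrete_open.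
Qed.

Lemma unspec_continuous : continuous unspec.
Proof.
move=> x U /biseq_nbhs[n hn].
pose e := cyl_idem (lword (unspec x) n) (rword (unspec x) n).
suff : nbhs x [set y : tight_spectrum S | set_val y e].
  apply: filterS => y /=; rewrite -[y]unspecK val_spec /Xi /= Dom_cyl_elt => c.
  apply: hn; rewrite specK; exact: agree_cyl c.
apply: open_nbhs_nbhs; split; first exact: spectrum_open.
by rewrite /= -[x in set_val x]unspecK val_spec /Xi /= Dom_cyl_elt cyl_trunc.
Qed.

(** By [alphaE] the action pulls [f] back to s* f s, whose domain is computed by [Dom_mul] and
    [Dom_star]. *)
Lemma alpha_Xi s z : Dom s z -> alpha (s : S) (Xi z) = Xi (sigma_pow (deg s) z).
Proof.
have ds : Dom (SP_mul (SP_star s) s) z = Dom s z.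
  by rewrite Dom_mul Dom_star -sigma_powD addNr sigma_pow0 andbb.
move=> d; rewrite alphaE; [|exact: Xi_filter|by rewrite /Xi /= ds].
apply: funext => f; rewrite /Xi.
have -> : val (conj_star (s : S) f) = SP_mul (SP_mul (SP_star s) (val f)) s.
  exact: (congr1 (SP_mul _) (@istarK S s)).
rewrite !Dom_mul deg_val sigma_pow0 d Dom_star -sigma_powD addNr sigma_pow0 d.
by rewrite andbT.
Qed.

Lemma pair_Dom (p : action_pair S) : Dom (pair_elt p) (unspec (pair_src p)).
Proof.
have := pair_dom p; rewrite -[x in set_val x]unspecK val_spec /Xi /=.
by rewrite Dom_mul => /andP[].
Qed.

Lemma Dom_pair s z : Dom s z -> set_val (spec z) (@idem_source S s).
Proof.
by move=> d; rewrite val_spec /Xi /= Dom_mul d Dom_star -sigma_powD addNr.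
Qed.

Lemma unspec_rng (p : action_pair S) :
  unspec (pair_rng p) = sigma_pow (deg (pair_elt p)) (unspec (pair_src p)).
Proof.
apply: spec_inj; rewrite unspecK; apply: spectrum_inj.
rewrite val_spec -alpha_Xi; last exact: pair_Dom.
by rewrite -val_spec unspecK.
Qed.

(** Multiplying by an idempotent defined at the source leaves the product nonzero, hence preserves
    the degree. Conversely, elements of equal degree agree below a window that is large for both
    ranks. *)
Lemma germ_degP (p q : action_pair S) : germ p = germ q <->
  pair_src p = pair_src q /\ deg (pair_elt p) = deg (pair_elt q).
Proof.
split=> [/germP/asboolP[e1 [e xe e2]]|[e1 e2]].
  split=> //.
  have de s : Dom s (unspec (pair_src p)) -> deg (SP_mul s (val e)) = deg s.
    move=> d; rewrite deg_mul ?deg_val ?addr0 // => n.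
    move: xe; rewrite -[x in set_val x]unspecK val_spec /Xi /= => xe.
    have : Dom (SP_mul s (val e)) (unspec (pair_src p)).
      by rewrite Dom_mul deg_val sigma_pow0 xe d.
    by rewrite n.
  rewrite -(de _ (pair_Dom p)) -(de (pair_elt q)) ?e1; last exact: pair_Dom.
  by congr deg.
have := pair_Dom q; rewrite -e1 => dq.
have dp := pair_Dom p.
apply/germP/asboolP; split=> //; set z := unspec (pair_src p) in dp dq.
pose k := (rank (pair_elt p) + rank (pair_elt q))%N.
exists (cyl_idem (lword z k) (rword z k)).
  by rewrite -[x in set_val x]unspecK val_spec /Xi /= Dom_cyl_elt cyl_trunc.
by apply: (mul_cyl_elt_germ dp dq e2 (cyl_trunc z k k));
  rewrite ?size_lword ?size_rword ?leq_addl ?leq_addr.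
Qed.

(** For [n = k] the element [e, w, e], with w the [k] letters right of the dot, carries them to the
    left. For [Negz k], which is -(k+1), the element [w, w, w], with w the [k.+1] letters left of
    the dot, carries them to the right. *)
Lemma shift_ex (n : int) z : exists s, deg s = n /\ Dom s z.
Proof.
case: n => [k|k].
  have e : [::] ++ rword z k = rword z k ++ [::] by rewrite cats0.
  exists (bracket [::] ([::] ++ rword z k) [::]).
  rewrite (deg_bracket e) (Dom_bracket _ e) size_rword subr0; split=> //.
  exact: (cyl_trunc z 0 k).
have e : lword z k.+1 ++ [::] = [::] ++ lword z k.+1 by rewrite cats0.
exists (bracket (lword z k.+1) (lword z k.+1 ++ [::]) (lword z k.+1)).
rewrite (deg_bracket e) (Dom_bracket _ e) size_lword sub0r NegzE; split=> //.
exact: (cyl_trunc z k.+1 0).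
Qed.

Definition shift_elt n z : SP X := projT1 (cid (shift_ex n z)).

Lemma deg_shift_elt n z : deg (shift_elt n z) = n.
Proof. by rewrite /shift_elt; case: cid => s []. Qed.

Lemma Dom_shift_elt n z : Dom (shift_elt n z) z.
Proof. by rewrite /shift_elt; case: cid => s []. Qed.

Definition to_shift (g : tight_groupoid S) : trans_groupoid (shift_action X) :=
  trans_elt (deg (pair_elt (repr g))) (unspec (pair_src (repr g))).

(** The choice made in [shift_elt] does not affect the germ, by [germ_degP]. *)
Definition of_shift (g : trans_groupoid (shift_action X)) : tight_groupoid S :=
  germ (mkpair (Dom_pair (Dom_shift_elt g.1 g.2))).

Lemma to_shiftK : cancel to_shift of_shift.
Proof.
move=> g; rewrite -[RHS]germ_repr; apply/germ_degP.
by rewrite /pair_src /pair_elt /= unspecK deg_shift_elt.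
Qed.

Lemma to_shiftE (p : action_pair S) :
  to_shift (germ p) = trans_elt (deg (pair_elt p)) (unspec (pair_src p)).
Proof.
by have /germ_degP[e1 e2] := germ_repr (germ p); rewrite /to_shift e1 e2.
Qed.

Lemma of_shiftK : cancel of_shift to_shift.
Proof.
case=> n z; rewrite to_shiftE /trans_elt /pair_elt /pair_src /=.
by rewrite deg_shift_elt specK.
Qed.

Lemma to_shift_comp (g h k : tight_groupoid S) :
  Defs.comp g h k <-> Defs.comp (to_shift g) (to_shift h) (to_shift k).
Proof.
have rngE q : unspec (pair_rng q) = trans_rng (shift_action X) (to_shift (germ q)).
  by rewrite unspec_rng to_shiftE.
split=> [[p [q [r [[<- <- <-] [e1 e2 e3]]]]]|[e1 e2]].
  split; first by rewrite -rngE to_shiftE /trans_src /= e1.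
  rewrite !to_shiftE e3 e2; congr trans_elt; apply: deg_mul => n.
  by have := pair_Dom r; rewrite e2 [imul _ _]n.
have pq : pair_src (repr g) = pair_rng (repr h).
  by apply: (can_inj unspecK); rewrite rngE germ_repr -e1.
suff <- : germ (pair_mul pq) = k.
  by rewrite -{1}(germ_repr g) -{1}(germ_repr h); exact: tight_comp_germ.
apply: (can_inj to_shiftK); rewrite e2 to_shiftE; congr trans_elt.
apply: deg_mul => n.
by have := pair_Dom (pair_mul pq); rewrite [pair_elt _]n.
Qed.

(** Basic open sets correspond to products of one integer with an open set of sequences, which
    yields the continuity of [of_shift]. *)
Lemma Theta_preimage (s : SP X) (U : set (tight_spectrum S)) :
  (forall x : tight_spectrum S, U x -> set_val x (@idem_source S s)) ->
  of_shift @^-1` @Theta S s U =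
  [set g | (g : trans_arrow (biseq X)).1 = deg s] `&` [set g | U (spec g.2)].
Proof.
move=> US; apply/seteqP; split=> -[n z] /=.
  move=> [p hp [es Up]].
  have := to_shiftE p; rewrite hp of_shiftK => -[en ez].
  by rewrite en es ez unspecK.
move=> [en Uz]; have d := US _ Uz.
exists (mkpair d) => //; apply/germ_degP.
by rewrite /pair_elt /pair_src /= deg_shift_elt.
Qed.

Lemma of_shift_continuous : continuous of_shift.
Proof.
move=> g U; rewrite nbhsE => -[C [[D sD <-] [A DA Ag]] CU].
(* Open sets are unions of finite intersections of sets in [Theta_base], so finitely many such sets
   have to be pulled back. *)
have [F [sF eA]] : exists F : {fset set (tight_arrow S)},
    (forall B, B \in F -> Theta_base B) /\ \bigcap_(B in [set` F]) B = A.
  by have [F sF eA] := sD _ DA; exists F; split=> // B /sF/set_mem.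
have : nbhs g (\bigcap_(B in [set` F]) (of_shift @^-1` B)).
  apply: filter_bigI => B FB; have [s [V [oV VS] eB]] := sF _ FB.
  apply: open_nbhs_nbhs; split; last by move: Ag; rewrite -eA; apply.
  rewrite eB Theta_preimage //; apply: openI.
    apply: (@open_comp _ _ (fun g : trans_arrow (biseq X) => g.1) [set n | n = deg s]).
      by move=> h _; exact: cvg_fst.
    exact: discrete_open.
  apply: (@open_comp _ _ (fun g : trans_arrow (biseq X) => spec g.2) V) => //.
  move=> h _; apply: continuous_comp; first exact: cvg_snd.
  exact: spec_continuous.
apply: filterS => h hF; apply: CU; exists A => //.
have : (\bigcap_(B in [set` F]) B) (of_shift h) by move=> B FB; exact: hF.
by rewrite eA.
Qed.

Lemma Theta_open (s : SP X) (U : set (tight_spectrum S)) : open U ->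
  (forall x : tight_spectrum S, U x -> set_val x (@idem_source S s)) ->
  open (@Theta S s U : set (tight_arrow S)).
Proof.
move=> oU US; exists [set @Theta S s U]; last by rewrite bigcup_set1.
move=> _ ->; exists [fset (@Theta S s U : set (tight_arrow S))]%fset.
  by move=> A; rewrite inE => /eqP ->; apply/mem_set; exists s, U.
by rewrite set_fset1 bigcap_set1.
Qed.

Lemma Theta_nbhs (p : action_pair S) (U : set (tight_spectrum S)) :
  open U -> U (pair_src p) -> nbhs (germ p : tight_arrow S)
    (Theta (pair_elt p)
      (U `&` [set x : tight_spectrum S | set_val x (idem_source (pair_elt p))])).
Proof.
move=> oU Up; apply: open_nbhs_nbhs; split.
  apply: Theta_open => [|x []//].
  by apply: openI oU _; exact: spectrum_open.
by exists p => //; split=> //; split=> //; exact: pair_dom.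
Qed.

(** The degree is constant on each [Theta s U], and the source stays in [U] there. *)
Lemma to_shift_continuous : continuous to_shift.
Proof.
have c1 : continuous (fun g : tight_arrow S =>
    deg (pair_elt (repr g)) : discrete_topology int).
  move=> g U; rewrite nbhs_principalE => /principal_filterP Ug.
  have := Theta_nbhs (p := repr g) openT I; rewrite germ_repr.
  apply: filterS => h [q <- [e _]] /=.
  have /germ_degP[_ ->] := germ_repr (germ q).
  by rewrite e.
pose f (g : tight_arrow S) : tight_spectrum S := pair_src (repr g).
have c2 : continuous f.
  move=> g U; rewrite nbhsE => -[V [oV Vg] VU].
  have := Theta_nbhs oV Vg; rewrite germ_repr.
  apply: filterS => h [q <- [_ [Vq _]]] /=; apply: VU.
  by have /germ_degP[e _] := germ_repr (germ q); rewrite /f e.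
have c3 : continuous (fun g : tight_arrow S => unspec (f g)).
  by move=> g; exact: (continuous_comp (c2 g) (@unspec_continuous (f g))).
exact: continuous_pair c1 c3.
Qed.

Lemma tight_groupoid_shift_iso :
  topGroupoid_iso (tight_groupoid S) (trans_groupoid (shift_action X)).
Proof.
exists to_shift, of_shift; split.
- exact: to_shiftK.
- exact: of_shiftK.
- exact: to_shift_continuous.
- exact: of_shift_continuous.
- exact: to_shift_comp.
Qed.

End TightGroupoidShift.

(** * Norms in C*-algebras *)

Section CstarAlgebras.
Variables (R : realType) (A : cstarAlgType R).
Implicit Types (x y : A) (u v : nat -> A).
Local Open Scope ring_scope.
Local Open Scope complex_scope.

Lemma cnorm0 : cnorm (0 : A) = 0.
Proof. by rewrite -(scale0r (0 : A)) cnormZ normr0 mul0r. Qed.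

Lemma cnormN x : cnorm (- x) = cnorm x.
Proof. by rewrite -scaleN1r cnormZ normrN1 mul1r. Qed.

Lemma cnorm_ge0 x : 0 <= cnorm x.
Proof.
have := cnormD x (- x); rewrite subrr cnorm0 cnormN -mulr2n.
by rewrite pmulrn_lge0.
Qed.

Lemma cnorm_eq0 x : (cnorm x == 0) = (x == 0).
Proof.
by apply/eqP/eqP => [|->]; [exact: cnorm0_eq0|exact: cnorm0].
Qed.

Lemma cnormB x y z : cnorm (x - z) <= cnorm (x - y) + cnorm (y - z).
Proof. by rewrite -[x - z](subrKA y) cnormD. Qed.

Lemma cnormC x y : cnorm (x - y) = cnorm (y - x).
Proof. by rewrite -cnormN opprB. Qed.

Lemma star0 : star (0 : A) = 0.
Proof. by apply: (@addrI _ (star 0)); rewrite -starD !addr0. Qed.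

Lemma starN x : star (- x) = - star x.
Proof. by apply: (@addIr _ (star x)); rewrite -starD !addNr star0. Qed.

Lemma star1 : star (1 : A) = 1.
Proof. by rewrite -[LHS]mulr1 -{2}(starK (1 : A)) -starM mulr1 starK. Qed.

Lemma star_sum (I : Type) (r : seq I) (P : pred I) (F : I -> A) :
  star (\sum_(i <- r | P i) F i) = \sum_(i <- r | P i) star (F i).
Proof. by apply: big_morph; [exact: starD|exact: star0]. Qed.

(** The C*-identity gives |y|^2 = |y* y| <= |y*| |y|; cancel |y|, then exchange y and y*. *)
Lemma cnorm_starE x : cnorm (star x) = cnorm x.
Proof.
suff h y : cnorm y <= cnorm (star y) by apply/eqP; rewrite eq_le h -{2}(starK x) h.
have [->|y0] := eqVneq y 0; first by rewrite star0.
have p : 0 < cnorm y by rewrite lt_def cnorm_eq0 y0 cnorm_ge0.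
by rewrite -(ler_pM2r p) -expr2 -cnorm_star; exact: cnormM.
Qed.

Lemma cnorm1_le : cnorm (1 : A) <= 1.
Proof.
have := cnorm_star (1 : A); rewrite star1 mulr1 expr2 => e.
have := cnorm_ge0 (1 : A); rewrite le_eqVlt => /predU1P[<-//|p].
by rewrite -(ler_pM2r p) -e mul1r.
Qed.

Definition cconv u x := forall e : R, 0 < e ->
  exists N, forall n, (N <= n)%N -> cnorm (u n - x) < e.

Lemma cconv_unique u x y : cconv u x -> cconv u y -> x = y.
Proof.
move=> ux uy; apply/eqP; rewrite -subr_eq0 -cnorm_eq0 eq_le cnorm_ge0 andbT.
apply/ler_addgt0Pr => e e0; rewrite add0r.
have [N hN] := ux _ (divr_gt0 e0 (ltr0Sn R 1)).
have [M hM] := uy _ (divr_gt0 e0 (ltr0Sn R 1)).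
apply: (le_trans (cnormB x (u (maxn N M)) y)); rewrite cnormC [leRHS]splitr.
by rewrite lerD // ltW // ?hN ?hM // ?leq_maxl ?leq_maxr.
Qed.

Lemma cconv_near u x : (exists N, forall n, (N <= n)%N -> u n = x) -> cconv u x.
Proof.
by move=> [N h] e e0; exists N => n /h ->; rewrite subrr cnorm0.
Qed.

Lemma cconvD u v x y : cconv u x -> cconv v y -> cconv (fun n => u n + v n) (x + y).
Proof.
move=> ux vy e e0.
have [N hN] := ux _ (divr_gt0 e0 (ltr0Sn R 1)).
have [M hM] := vy _ (divr_gt0 e0 (ltr0Sn R 1)).
exists (maxn N M) => n; rewrite geq_max => /andP[/hN h1 /hM h2].
rewrite opprD addrACA (le_lt_trans (cnormD _ _)) // [ltRHS]splitr.
exact: ltrD.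
Qed.

Lemma cconvZ (a : R[i]) u x : cconv u x -> cconv (fun n => a *: u n) (a *: x).
Proof.
move=> ux e e0; pose c := complex.Re `|a|.
have c0 : 0 <= c by have := normr_ge0 a; rewrite lecE => /andP[].
have c1 : 0 < c + 1 by rewrite ltr_wpDl.
have [N hN] := ux _ (divr_gt0 e0 c1); exists N => n /hN.
rewrite ltr_pdivlMr // -scalerBr cnormZ -/c; apply: le_lt_trans.
by rewrite mulrC ler_wpM2l ?cnorm_ge0 // lerDl.
Qed.

Lemma cconv_star u x : cconv u x -> cconv (fun n => star (u n)) (star x).
Proof.
move=> ux e e0; have [N hN] := ux _ e0; exists N => n /hN.
by rewrite -starN -starD cnorm_starE.
Qed.

Lemma cconvM u v x y : cconv u x -> cconv v y -> cconv (fun n => u n * v n) (x * y).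
Proof.
move=> ux vy e e0.
pose a := cnorm x + 1; pose b := cnorm y + 1.
have a0 : 0 < a by rewrite ltr_wpDl ?cnorm_ge0.
have b0 : 0 < b by rewrite ltr_wpDl ?cnorm_ge0.
(* From [K] on, the norm of [u n] is at most [a]. *)
have [K hK] := ux _ ltr01.
have [N hN] := ux _ (divr_gt0 (divr_gt0 e0 (ltr0Sn R 1)) b0).
have [M hM] := vy _ (divr_gt0 (divr_gt0 e0 (ltr0Sn R 1)) a0).
exists (maxn K (maxn N M)) => n; rewrite !geq_max => /and3P[/hK h0 /hN h1 /hM h2].
have -> : u n * v n - x * y = u n * (v n - y) + (u n - x) * y.
  by rewrite mulrBr mulrBl addrA subrK.
rewrite (le_lt_trans (cnormD _ _)) // [ltRHS]splitr ltrD //.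
  apply: le_lt_trans (cnormM _ _) _; rewrite mulrC; move: h2.
  rewrite ltr_pdivlMr //; apply: le_lt_trans; rewrite ler_wpM2l ?cnorm_ge0 //.
  rewrite -[u n](subrK x) (le_trans (cnormD _ _)) // addrC lerD2l; exact: ltW.
apply: le_lt_trans (cnormM _ _) _; move: h1.
rewrite ltr_pdivlMr //; apply: le_lt_trans; rewrite ler_wpM2l ?cnorm_ge0 //.
by rewrite lerDl.
Qed.

Lemma cconv_ex u : (forall e : R, 0 < e -> exists N, forall m n, (N <= m)%N ->
    (N <= n)%N -> cnorm (u m - u n) < e) -> exists x, cconv u x.
Proof. exact: cnorm_complete. Qed.

(** Orthogonality kills the product term in each step of the join. *)
Lemma proj_join_orth (I : eqType) (s : seq I) (F : I -> A) : uniq s ->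
  (forall i j, i != j -> F i * F j = 0) ->
  proj_join (map F s) = \sum_(i <- s) F i.
Proof.
move=> + h; elim: s => [|i s IH] /=; first by rewrite big_nil.
move=> /andP[si us]; rewrite /= IH // big_cons [X in _ - X](_ : _ = 0) ?subr0 // mulr_sumr big_seq.
by apply: big1 => j js; rewrite h //; apply: contraNneq si => ->.
Qed.
End CstarAlgebras.

(** * Homomorphisms on continuous functions *)

Section FunctionHomomorphisms.
Variables (R : realType) (Y : topologicalType).
Implicit Types (f g h : CY R Y).
Local Open Scope ring_scope.
Local Open Scope complex_scope.

Record is_CY_hom (A : cstarAlgType R) (F : CY R Y -> A) : Prop := IsCYHom {
  CYhomD : {morph F : f g / f + g};
  CYhomZ : forall (a : R[i]) f, F (a *: f) = a *: F f;
  CYhomM : {morph F : f g / f * g};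
  CYhom1 : F 1 = 1;
  CYhom_star : forall f, F (CY_conj f) = star (F f)
}.

Lemma CY_addE f g y : (f + g) y = f y + g y. Proof. by []. Qed.
Lemma CY_mulE f g y : (f * g) y = f y * g y. Proof. by []. Qed.
Lemma CY_oppE f y : (- f) y = - f y. Proof. by []. Qed.
Lemma CY_scaleE (a : R[i]) f y : (a *: f) y = a * f y. Proof. by []. Qed.
Lemma CY_conjE f y : CY_conj f y = conjc (f y). Proof. by []. Qed.
Lemma CY_1E y : (1 : CY R Y) y = 1. Proof. by []. Qed.
Lemma CY_0E y : (0 : CY R Y) y = 0. Proof. by []. Qed.
Definition CYE := (CY_addE, CY_mulE, CY_oppE, CY_scaleE, CY_conjE, CY_1E, CY_0E).

Lemma CY_sumE (I : Type) (r : seq I) (P : pred I) (F : I -> CY R Y) y :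
  (\sum_(i <- r | P i) F i) y = \sum_(i <- r | P i) F i y.
Proof. by apply: (big_morph (fun f : CY R Y => f y)). Qed.

Lemma Re_continuous : continuous (fun x : R[i]^o => complex.Re x : R^o).
Proof.
move=> x A [e e0 sA]; exists e%:C; first by rewrite /= ltcR.
move=> t xt; apply: sA; move: xt; rewrite /ball_ /= => xt.
rewrite -ltcR; apply: le_lt_trans xt.
have -> : complex.Re x - complex.Re t = complex.Re (x - t) by case: x t => ? ? [].
exact: normc_ge_Re.
Qed.

Lemma real_complex_continuous : continuous (fun r : R^o => r%:C : R[i]^o).
Proof.
move=> x A [e e0 sA]; move: e0; rewrite /= ltcE /= => /andP[/eqP ie re].
exists (complex.Re e); first exact: re.
move=> t xt; apply: sA; move: xt; rewrite /ball_ /= => xt.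
rewrite -rmorphB /= normc_def /= expr0n addr0 sqrtr_sqr.
by rewrite ltcE /= ie eqxx.
Qed.

Lemma CY_sqrt_continuous h :
  continuous (fun y => (Num.sqrt (1 - complex.Re (h y) ^+ 2))%:C : R[i]^o).
Proof.
move=> y; apply: (@continuous_comp _ R^o _
  (fun y => Num.sqrt (1 - complex.Re (h y) ^+ 2)) (fun r : R^o => r%:C : R[i]^o)); last first.
  exact: real_complex_continuous.
apply: (@continuous_comp _ R^o R^o (fun y => 1 - complex.Re (h y) ^+ 2) Num.sqrt);
  last exact: sqrt_continuous.
have c : {for y, continuous (fun y => complex.Re (h y) : R^o)}.
  apply: (@continuous_comp _ (R[i]^o) R^o h); first exact: cts_fun.
  exact: Re_continuous.
apply: cvgB; first exact: cvg_cst.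
by under eq_fun do rewrite expr2; apply: cvgM.
Qed.

Lemma conjci : conjc 'i%C = - 'i%C :> R[i].
Proof. by apply/eqP; rewrite eq_complex /= oppr0 !eqxx. Qed.

Lemma conjc_rect (r t : R) : conjc (r%:C + 'i%C * t%:C) = r%:C - 'i%C * t%:C.
Proof.
by apply/eqP; rewrite eq_complex /= !(mul0r, mul1r, mulr0, add0r, addr0, subr0, oppr0) !eqxx.
Qed.

Lemma conjcD (z w : R[i]) : conjc (z + w) = conjc z + conjc w.
Proof. exact: rmorphD. Qed.

Lemma conjcN (z : R[i]) : conjc (- z) = - conjc z.
Proof. exact: rmorphN. Qed.

Lemma conjcM (z w : R[i]) : conjc (z * w) = conjc z * conjc w.
Proof. exact: rmorphM. Qed.

Lemma scaler_half (V : lmodType R[i]) (x : V) : 2^-1 *: (x + x) = x.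
Proof. by rewrite -mulr2n -[x *+ 2]scaler_nat scalerA mulVf ?scale1r // pnatr_eq0. Qed.

(* A real-valued [h] with [|h| <= 1] is the real part of the unitary
   [h + i sqrt(1 - h^2)]. *)
Lemma CY_hom_real_bound (A : cstarAlgType R) (F : CY R Y -> A) h :
  is_CY_hom F -> CY_conj h = h -> (forall y, `|h y| <= 1) -> cnorm (F h) <= 1.
Proof.
move=> hF hh h1; pose q : CY R Y := mkcts (@CY_sqrt_continuous h).
pose u := h + 'i%C *: q.
have hr y : h y = (complex.Re (h y))%:C.
  have := congr1 (fun f : CY R Y => f y) hh; rewrite CY_conjE.
  case: (h y) => a b [] /eqP; rewrite eq_sym -subr_eq0 opprK -mulr2n.
  by rewrite mulrn_eq0 /= => /eqP ->.
have cu : CY_conj u = h - 'i%C *: q.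
  apply: CY_eq => y; rewrite !CYE hr; exact: conjc_rect.
have uu : CY_conj u * u = 1.
  apply: CY_eq => y; rewrite cu !CYE.
  have := h1 y; rewrite hr normc_def /= expr0n addr0 sqrtr_sqr lecR => hy.
  rewrite /q /=; set r := complex.Re (h y) in hy *.
  have -> : (r%:C - 'i%C * (Num.sqrt (1 - r ^+ 2))%:C) *
      (r%:C + 'i%C * (Num.sqrt (1 - r ^+ 2))%:C) =
    (r ^+ 2 + Num.sqrt (1 - r ^+ 2) ^+ 2)%:C.
    rewrite -subr_sqr exprMn sqr_i mulN1r opprK rmorphD !rmorphXn //.
  rewrite sqr_sqrtr ?subrKC // subr_ge0.
  by rewrite -(@real_normK _ r) ?num_real // expr_le1.
(* By the C*-identity |F u|^2 = |F (u* u)| = |1|. *)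
have nu : cnorm (F u) <= 1.
  rewrite -(@expr_le1 _ 2) ?cnorm_ge0 // -cnorm_star -(CYhom_star hF) -(CYhomM hF) uu.
  by rewrite (CYhom1 hF) cnorm1_le.
have -> : h = 2^-1 *: (u + CY_conj u).
  by rewrite cu addrACA subrr addr0 scaler_half.
rewrite (CYhomZ hF) (CYhomD hF) (CYhom_star hF) cnormZ.
have -> : `|(2^-1 : R[i])| = (2^-1 : R)%:C.
  by rewrite ger0_norm ?invr_ge0 ?ler0n // fmorphV rmorph_nat.
rewrite /= mulrC ler_pdivrMr // mul1r (le_trans (cnormD _ _)) // cnorm_starE.
by rewrite (_ : 2 = 1 + 1) // lerD.
Qed.

(** The real and imaginary parts of [f] are each bounded by [CY_hom_real_bound], whence the constant
    2. *)
Lemma CY_hom_bound1 (A : cstarAlgType R) (F : CY R Y -> A) f :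
  is_CY_hom F -> (forall y, `|f y| <= 1) -> cnorm (F f) <= 2.
Proof.
move=> hF f1.
pose a := 2^-1 *: (f + CY_conj f); pose b := (2^-1 * - 'i%C) *: (f - CY_conj f).
have n2 : `|(2^-1 : R[i])| = 2^-1 by rewrite ger0_norm ?invr_ge0 ?ler0n.
have ni : `|'i%C : R[i]| = 1 by rewrite normc_def /= expr0n add0r expr1n sqrtr1.
have c2 : conjc (2^-1 : R[i]) = 2^-1 by rewrite fmorphV rmorph_nat.
have ef : f = a + 'i%C *: b.
  have -> : 'i%C *: b = 2^-1 *: (f - CY_conj f).
    by rewrite scalerA mulrCA mulrN -expr2 sqr_i opprK mulr1.
  by rewrite -scalerDr addrACA subrr addr0 scaler_half.
have half (z w : R[i]) : `|z| <= 1 -> `|w| <= 1 -> `|z + w| <= 2.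
  by move=> z1 w1; rewrite (le_trans (ler_normD _ _)) // (_ : 2 = 1 + 1) // lerD.
have ha : cnorm (F a) <= 1.
  apply: CY_hom_real_bound => // [|y].
    by apply: CY_eq => y; rewrite !CYE conjcM conjcD c2 conjcK [_^* + _]addrC.
  rewrite !CYE normrM n2 mulrC ler_pdivrMr // mul1r; apply: half; rewrite ?normcJ; exact: f1.
have hb : cnorm (F b) <= 1.
  apply: CY_hom_real_bound => // [|y].
    apply: CY_eq => y; rewrite !CYE !(conjcM, conjcD, conjcN) c2 conjcK conjci.
    by rewrite opprK mulrN mulNr -mulrN opprB.
  rewrite !CYE !normrM normrN n2 ni mulr1 mulrC ler_pdivrMr // mul1r.
  by apply: half; rewrite ?normrN ?normcJ; exact: f1.
rewrite ef (CYhomD hF) (CYhomZ hF 'i%C b) (le_trans (cnormD _ _)) //.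
rewrite [cnorm ('i%C *: _)]cnormZ ni mul1r.
by rewrite (_ : 2 = 1 + 1) // lerD.
Qed.

Lemma CY_hom_bound (A : cstarAlgType R) (F : CY R Y -> A) f (e : R) :
  is_CY_hom F -> 0 < e -> (forall y, `|f y| <= e%:C) -> cnorm (F f) <= 2 * e.
Proof.
move=> hF e0 fe; have eC : 0 < e%:C by rewrite ltcR.
have ee : `|e%:C| = e%:C by rewrite gtr0_norm.
have e1 : e%:C != 0 by rewrite gt_eqF.
have -> : f = e%:C *: (e%:C^-1 *: f) by rewrite scalerA divff // scale1r.
rewrite (CYhomZ hF) cnormZ ee /= mulrC ler_pM2r //.
apply: CY_hom_bound1 => // y.
by rewrite CYE normrM normfV ee mulrC ler_pdivrMr // mul1r.
Qed.

End FunctionHomomorphisms.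

(** * Indicator functions and uniform continuity *)

Section BiseqFunctions.
Variables (R : realType) (X : finType).
Implicit Types (z w : biseq X) (s t : SP X) (f g : CY R (biseq X)).
Local Open Scope classical_set_scope.
Local Open Scope ring_scope.
Local Open Scope complex_scope.

(** This is the join formula p + q - p q of commuting projections, evaluated at a point. *)
Lemma natr_orb (a b : bool) : (a || b)%:R = a%:R + b%:R - a%:R * b%:R :> R[i].
Proof. by case: a; rewrite ?mul1r ?addrK // mul0r add0r subr0. Qed.

Lemma ind_continuous s : continuous (fun z => (Dom s z)%:R : R[i]^o).
Proof.
move=> z U Uz.
apply: filterS (agree_nbhs (rank s) z) => w /(Dom_agree (leqnn _)) h.
by rewrite /= -h; exact: nbhs_singleton.
Qed.

Definition ind s : CY R (biseq X) := mkcts (@ind_continuous s).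

Lemma indE s z : ind s z = (Dom s z)%:R. Proof. by []. Qed.

Lemma agree_le m n z w : (m <= n)%N -> agree n z w -> agree m z w.
Proof. by move=> mn h i im; apply: h; exact: leq_trans mn. Qed.

(** Uniform continuity from compactness. The window has length [n.+1] so that it is never empty, as
    [cyl_approx_le] requires. *)
Lemma CY_uniform f (e : R) : 0 < e ->
  exists n, forall z w, agree n.+1 z w -> `|f z - f w| <= e%:C.
Proof.
move=> e0; have e20 : 0 < (e / 2)%:C by rewrite ltcR divr_gt0.
have cov := (compact_near_coveringP [set: biseq X]).1 (@biseq_compact X).
pose P n z := forall w, agree n z w -> `|f z - f w| <= e%:C.
have [|N _ hN] := cov nat eventually P _.
  move=> z _.
  have nz : nbhs z [set z' : biseq X | `|f z - f z'| < (e / 2)%:C].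
    apply: (@cts_fun _ _ f z [set a | `|f z - a| < (e / 2)%:C]).
    by exists (e / 2)%:C.
  have [n hn] := biseq_nbhs nz.
  (* If z' shares the [n]-window of [z] and [w] shares at least that window of z', then both values
     of [f] are within e/2 of [f z]. *)
  exists ([set z' : biseq X | agree n z z'], [set m | (n <= m)%N]).
    by split; [exact: agree_nbhs|exists n].
  move=> [z' m] [/= az nm] w aw.
  have h1 := hn _ az; have h2 : `|f z - f w| < (e / 2)%:C.
    apply: hn => i im; have [-> ->] := az _ im; apply: aw.
    exact: leq_trans nm.
  rewrite -[f z'](subrK (f z)) -addrA (le_trans (ler_normD _ _)) //.
  rewrite [e]splitr rmorphD lerD // ?(distrC (f z')) ltW //.
exists N => z w a; apply: (hN N (leqnn _) z I); exact: agree_le a.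
Qed.

End BiseqFunctions.

(** * Tight and covariant representations *)

Section Covers.
Variables (X : finType) (X_nonempty : (0 < #|X|)%N).
Local Notation S := (SP_monoid X).
Implicit Types (z w : biseq X) (s t : SP X) (e c : idem S).

Lemma Dom_le e (f : idem S) z : idem_le (val e) (val f) -> Dom (val e) z -> Dom (val f) z.
Proof.
move=> ef de; have := Dom_idem_mul e f z.
by rewrite [SP_mul _ _]ef de => /esym/andP[].
Qed.

(** Abstract covers are pointwise covers. A small window around [z] lies below [e], so it meets some
    [c] of the cover; the window being large enough to decide [c], this [c] is defined at [z]
    itself. *)
Lemma cover_Dom e (C : seq (idem S)) z : is_cover e C ->
  Dom (val e) z = has (fun c : idem S => Dom (val c) z) C.
Proof.
move=> [le cov]; apply/idP/hasP => [d|[c cC dc]]; last exact: Dom_le (le _ cC) dc.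
(* This window decides [e] and all members of the cover at once. *)
pose n := (rank (val e) + \max_(c <- C) rank (val c))%N.
pose f := cyl_idem (lword z n) (rword z n).
have zf : Dom (val f) z by rewrite Dom_cyl_elt cyl_trunc.
have [||c cC cf] := cov f.
- by move=> f0; rewrite f0 in zf.
- apply: (@cyl_elt_absorb _ (val e) _ _ z (idemP e) d (cyl_trunc z n n));
    by rewrite ?size_lword ?size_rword leq_addr.
exists c => //.
have [w] := Dom_nonempty X_nonempty cf; rewrite Dom_idem_mul => /andP[cw].
rewrite Dom_cyl_elt => /(agree_cyl (leqnn n) (leqnn n)) zw.
rewrite (@Dom_agree _ _ n z w) //.
apply: leq_trans (leq_addl _ _).
exact: (@leq_bigmax_seq _ C xpredT (fun c => rank (val c)) c cC).
Qed.

Lemma Dom_cover e (C : seq (idem S)) :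
  (forall c, c \in C -> idem_le (val c) (val e)) ->
  (forall z, Dom (val e) z -> has (fun c : idem S => Dom (val c) z) C) ->
  is_cover e C.
Proof.
move=> le h; split=> // f f0 fe.
have [z df] := Dom_nonempty X_nonempty f0.
have /hasP[c cC dc] := h z (Dom_le fe df); exists c => // cf.
by have := Dom_idem_mul c f z; rewrite dc df [SP_mul _ _]cf.
Qed.

End Covers.

(** * From covariant to tight representations *)

Section CovariantToTight.
Variables (R : realType) (X : finType) (X_nonempty : (0 < #|X|)%N).
Variables (A : cstarAlgType R) (rho : CY R (biseq X) -> A) (U : int -> A).
Hypothesis hcov : is_covariant_rep (shift_action X) rho U.
Local Notation S := (SP_monoid X).
Implicit Types (s t : SP X) (f g : CY R (biseq X)).
Local Open Scope ring_scope.

Lemma covariant_CY_hom : is_CY_hom rho.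
Proof. by case: hcov. Qed.

Lemma cov_swap f n : rho f * U n = U n * rho (CY_act (shift_action X) (- n) f).
Proof.
rewrite -(cov_conj hcov) (covU_star hcov) opprK !mulrA -(covUD hcov) subrr.
by rewrite (covU0 hcov) mul1r.
Qed.

Lemma CY_actE n f z : CY_act (shift_action X) n f z = f (sigma_pow (- n) z).
Proof. by []. Qed.

(** It copies the recursion of [proj_join], so that [rho] carries it to the join of projections term
    by term; its value is the indicator of the union of the domains. *)
Fixpoint ind_union (C : seq (idem S)) : CY R (biseq X) :=
  if C is c :: C' then ind R (val c) + ind_union C' - ind R (val c) * ind_union C'
  else 0.

Lemma ind_union_cons c C : ind_union (c :: C) =
  ind R (val c) + ind_union C - ind R (val c) * ind_union C.
Proof. by []. Qed.

Lemma ind_unionE C z : ind_union C z = (has (fun c : idem S => Dom (val c) z) C)%:R.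
Proof.
elim: C => [//|c C IH]; rewrite ind_union_cons CY_addE CY_oppE CY_mulE CY_addE IH indE.
rewrite -[has _ (c :: C)]/(Dom (val c) z || _).
by rewrite natr_orb.
Qed.

Lemma CY_homN F f : @is_CY_hom R (biseq X) A F -> F (- f) = - F f.
Proof. by move=> hF; rewrite -[- f]scaleN1r (CYhomZ hF) scaleN1r. Qed.

Definition tight_of_cov (s : S) : A := U (deg s) * rho (ind R s).

Lemma CY_hom0 F : @is_CY_hom R (biseq X) A F -> F 0 = 0.
Proof. by move=> hF; rewrite -(scale0r (0 : CY R _)) (CYhomZ hF) scale0r. Qed.

Lemma ind0 : ind R (None : SP X) = 0. Proof. exact: CY_eq. Qed.

Lemma tight_of_cov_mul s t :
  tight_of_cov (SP_mul s t) = tight_of_cov s * tight_of_cov t.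
Proof.
rewrite /tight_of_cov -mulrA (mulrA (rho _)) cov_swap -!mulrA -(covM hcov).
rewrite mulrA -(covUD hcov).
have -> : CY_act (shift_action X) (- deg t) (ind R s) * ind R t = ind R (SP_mul s t).
  apply: CY_eq => z; rewrite CY_mulE CY_actE opprK !indE Dom_mul.
  by case: (Dom t z); rewrite ?mulr1 ?mulr0.
case: (pselect (SP_mul s t = None)) => [->|/deg_mul -> //].
by rewrite ind0 (CY_hom0 covariant_CY_hom) !mulr0.
Qed.

Lemma tight_of_cov_idem (e : idem S) : tight_of_cov (val e) = rho (ind R (val e)).
Proof. by rewrite /tight_of_cov deg_val (covU0 hcov) mul1r. Qed.

Lemma tight_of_cov_tight : @is_tight_rep R S A tight_of_cov.
Proof.
split.
- exact: tight_of_cov_mul.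
- move=> s; rewrite /tight_of_cov starM -(cov_star hcov) (covU_star hcov) cov_swap.
  rewrite opprK deg_star; congr (_ * rho _); apply: CY_eq => z.
  by rewrite CY_actE CY_conjE !indE Dom_star conjc_nat.
- by rewrite /tight_of_cov ind0 (CY_hom0 covariant_CY_hom) mulr0.
- have := tight_of_cov_idem (cyl_idem [::] [::]); rewrite [val _]/= cyl_elt_nil => ->.
  rewrite -(cov1 hcov); congr rho; apply: CY_eq => z; rewrite indE -cyl_elt_nil.
  by rewrite Dom_cyl_elt.
move=> e C cov; rewrite tight_of_cov_idem.
under eq_map do rewrite tight_of_cov_idem.
have -> : ind R (val e) = ind_union C.
  by apply: CY_eq => z; rewrite indE (cover_Dom X_nonempty _ cov) ind_unionE.
elim: C {cov} => [|c C IH]; first by rewrite (CY_hom0 covariant_CY_hom).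
rewrite ind_union_cons (covD hcov) (CY_homN _ covariant_CY_hom) (covD hcov).
by rewrite (covM hcov) -IH.
Qed.

End CovariantToTight.

(** * Approximation by functions constant on cylinders *)

Section CylinderApproximation.
Variables (R : realType) (X : finType) (X_nonempty : (0 < #|X|)%N).
Implicit Types (z w : biseq X) (f g : CY R (biseq X)).
Local Open Scope ring_scope.
Local Open Scope complex_scope.

Definition cylpt u v : biseq X := projT1 (cid (exists_cyl X_nonempty u v)).

Lemma cyl_cylpt u v : cyl u v (cylpt u v).
Proof. by rewrite /cylpt; case: cid. Qed.

Definition window n : finType := (n.-tuple X * n.-tuple X)%type.

Definition window_pt n (i : window n) : biseq X := cylpt i.1 i.2.
Definition window_idem n (i : window n) : idem (SP_monoid X) := cyl_idem i.1 i.2.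

Definition window_of n z : window n :=
  (Tuple (introT eqP (size_lword z n)), Tuple (introT eqP (size_rword z n))).

Lemma Dom_window_idem n (i : window n) z : Dom (val (window_idem i)) z = (i == window_of n z).
Proof.
rewrite Dom_cyl_elt; apply/idP/eqP => [c|->]; last exact: cyl_trunc.
have [||e1 e2] := @cyl_inj X i.1 i.2 _ _ z _ _ c (cyl_trunc z n n).
- by rewrite size_lword size_tuple.
- by rewrite size_rword size_tuple.
by case: i e1 e2 {c} => i1 i2 e1 e2; congr pair; apply: val_inj.
Qed.

Lemma agree_window_pt n z : agree n z (window_pt (window_of n z)).
Proof. by apply: (@agree_cyl _ n n) => //; exact: cyl_cylpt. Qed.

Definition cyl_approx n f : CY R (biseq X) :=
  \sum_(i : window n) f (window_pt i) *: ind R (val (window_idem i)).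

Lemma cyl_approxE n f z : cyl_approx n f z = f (window_pt (window_of n z)).
Proof.
rewrite /cyl_approx CY_sumE (bigD1 (window_of n z)) // big1 => [|i /andP[_ ne]].
  by rewrite [LHS]addr0 CY_scaleE indE Dom_window_idem eqxx mulr1.
by rewrite CY_scaleE indE Dom_window_idem (negbTE ne) mulr0.
Qed.

Lemma cyl_approx_le f (e : R) : 0 < e -> exists2 n, (0 < n)%N &
  forall m, (n <= m)%N -> forall z, `|(f - cyl_approx m f) z| <= e%:C.
Proof.
move=> e0; have [n hn] := CY_uniform f e0; exists n.+1 => // m nm z.
rewrite CY_addE CY_oppE cyl_approxE; apply: hn.
exact: agree_le nm (agree_window_pt z).
Qed.

Lemma CY_hom_sum (A : cstarAlgType R) (F : CY R (biseq X) -> A) (I : Type)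
    (r : seq I) (P : pred I) (a : I -> R[i]) (G : I -> CY R (biseq X)) :
  is_CY_hom F -> F (\sum_(i <- r | P i) a i *: G i) = \sum_(i <- r | P i) a i *: F (G i).
Proof.
move=> hF; rewrite (big_morph F (CYhomD hF) (CY_hom0 hF)).
by apply: eq_bigr => i _; rewrite (CYhomZ hF).
Qed.

Lemma CY_homB (A : cstarAlgType R) (F : CY R (biseq X) -> A) f g :
  is_CY_hom F -> F (f - g) = F f - F g.
Proof. by move=> hF; rewrite (CYhomD hF) (CY_homN _ hF). Qed.

(** The two homomorphisms agree on step functions, which approximate [f] uniformly, and both are
    bounded. Only windows with [0 < n] are compared because such a window fixes a letter right of
    the dot, as used in [conj_shift_unitary]. *)
Lemma CY_hom_ext (A : cstarAlgType R) (F G : CY R (biseq X) -> A) :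
  is_CY_hom F -> is_CY_hom G ->
  (forall n (i : window n), (0 < n)%N ->
    F (ind R (val (window_idem i))) = G (ind R (val (window_idem i)))) ->
  forall f, F f = G f.
Proof.
move=> hF hG FG f; apply/eqP; rewrite -subr_eq0 -cnorm_eq0 eq_le cnorm_ge0 andbT.
apply/ler_addgt0Pr => e e0; rewrite add0r.
(* Each of the two homomorphisms contributes an error of at most 2 (e/4). *)
have e4 : 0 < e / 4 by rewrite divr_gt0.
have [n n0 /(_ n (leqnn n)) hn] := cyl_approx_le f e4.
have eFG : F (cyl_approx n f) = G (cyl_approx n f).
  rewrite /cyl_approx !CY_hom_sum //; apply: eq_bigr => i _.
  by rewrite FG.
have -> : F f - G f = F (f - cyl_approx n f) - G (f - cyl_approx n f).
  by rewrite !CY_homB // eFG opprB addrA subrK.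
rewrite (le_trans (cnormD _ _)) // cnormN.
have -> : e = 2 * (e / 4) + 2 * (e / 4) by lra.
by rewrite lerD // CY_hom_bound.
Qed.

End CylinderApproximation.

(** * From a tight representation to continuous functions *)

Section TightToFunctions.
Variables (R : realType) (X : finType) (X_nonempty : (0 < #|X|)%N).
Local Notation S := (SP_monoid X).
Variables (A : cstarAlgType R) (pi : S -> A).
Hypothesis hpi : is_tight_rep pi.
Implicit Types (z w : biseq X) (s t : SP X) (f g : CY R (biseq X)).
Local Open Scope ring_scope.
Local Open Scope complex_scope.

(** Idempotents whose domains partition the space form a cover of the unit, and being orthogonal
    they have their sum as join. *)
Lemma tight_rep_partition (I : finType) (c : I -> idem S) :
  (forall z i j, Dom (val (c i)) z -> Dom (val (c j)) z -> i = j) ->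
  (forall z, exists i, Dom (val (c i)) z) ->
  \sum_i pi (val (c i)) = 1.
Proof.
move=> disj cov.
have <- : pi (val (cyl_idem [::] [::] : idem S)) = 1.
  by rewrite -(tight_rep1 hpi).
rewrite -(@tight_rep_cover _ _ _ _ hpi _ [seq c i | i <- enum I]).
  rewrite -map_comp (proj_join_orth (F := fun i => pi (val (c i)))) ?enum_uniq ?big_enum //.
  move=> i j ij; rewrite -(tight_repM hpi).
  rewrite [imul _ _](_ : _ = izero S) ?(tight_rep0 hpi) //.
  apply: (Dom_empty X_nonempty) => z; rewrite Dom_idem_mul; apply/andP => -[h1 h2].
  by rewrite (disj z i j h1 h2) eqxx in ij.
apply: Dom_cover => // [c' _|z _].
  exact: (@imuls1 S).
have [i hi] := cov z; apply/hasP; exists (c i) => //.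
by apply/map_f; rewrite mem_enum.
Qed.

Notation window_idem := (@window_idem X _).
Notation window_pt := (window_pt X_nonempty).

Lemma tight_rep_windows n : \sum_(i : window X n) pi (val (window_idem i)) = 1.
Proof.
apply: tight_rep_partition => [z i j|z].
  by rewrite !Dom_window_idem => /eqP -> /eqP ->.
by exists (window_of n z); rewrite Dom_window_idem.
Qed.

(** Multiply by the partition of 1 into windows: a window of length at least the rank is either
    below [e] or orthogonal to it, according to its sample point. *)
Lemma tight_rep_decomp n (e : idem S) : (rank (val e) <= n)%N ->
  pi (val e) = \sum_(i : window X n) (Dom (val e) (window_pt i))%:R *: pi (val (window_idem i)).
Proof.
move=> le; rewrite -[LHS]mul1r -(tight_rep_windows n) mulr_suml.
apply: eq_bigr => i _; rewrite -(tight_repM hpi).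
have c : cyl i.1 i.2 (window_pt i) by exact: cyl_cylpt.
case d: (Dom (val e) (window_pt i)).
  rewrite scale1r; congr pi; apply: (cyl_elt_absorb (idemP e) d c);
    by rewrite size_tuple.
rewrite scale0r -(tight_rep0 hpi); congr pi.
apply: (Dom_empty X_nonempty) => z; rewrite Dom_idem_mul; apply/andP => -[].
rewrite Dom_window_idem => /eqP ei dz.
by move: d; rewrite ei -(Dom_agree le (agree_window_pt X_nonempty z)) dz.
Qed.

Lemma tight_rep_window_star n (i : window X n) :
  star (pi (val (window_idem i))) = pi (val (window_idem i)).
Proof. by rewrite -(tight_rep_star hpi) istar_idem // idemP. Qed.

Lemma tight_rep_window_orth n (i j : window X n) :
  pi (val (window_idem i)) * pi (val (window_idem j)) = (i == j)%:R *: pi (val (window_idem i)).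
Proof.
rewrite -(tight_repM hpi); have [->|ij] := eqVneq i j; first by rewrite scale1r idemP.
rewrite scale0r -(tight_rep0 hpi); congr pi.
apply: (Dom_empty X_nonempty) => z; rewrite Dom_idem_mul !Dom_window_idem.
by apply/andP => -[/eqP e1 /eqP e2]; rewrite e1 -e2 eqxx in ij.
Qed.

Definition sample n f : A := \sum_(i : window X n) f (window_pt i) *: pi (val (window_idem i)).

(** The windows of one length give orthogonal self-adjoint projections with sum 1, so sampling is a
    homomorphism for each [n]. *)
Lemma sample_CY_hom n : is_CY_hom (sample n).
Proof.
split.
- move=> f g; rewrite /sample -big_split; apply: eq_bigr => i _.
  by rewrite CY_addE scalerDl.
- move=> a f; rewrite /sample scaler_sumr; apply: eq_bigr => i _.
  by rewrite CY_scaleE scalerA.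
- move=> f g; rewrite /sample mulr_suml; apply: eq_bigr => i _.
  rewrite mulr_sumr (bigD1 i) // big1 => [|j /andP[_ ji]].
    by rewrite [RHS]addr0 -scalerAl -scalerAr tight_rep_window_orth eqxx scale1r scalerA CY_mulE.
  by rewrite -scalerAl -scalerAr tight_rep_window_orth eq_sym (negbTE ji) scale0r !scaler0.
- rewrite /sample -(tight_rep_windows n); apply: eq_bigr => i _.
  by rewrite CY_1E scale1r.
- move=> f; rewrite /sample star_sum; apply: eq_bigr => i _.
  by rewrite starZ tight_rep_window_star CY_conjE.
Qed.

Lemma sample_ind n (e : idem S) : (rank (val e) <= n)%N ->
  sample n (ind R (val e)) = pi (val e).
Proof. by move=> le; rewrite (tight_rep_decomp le). Qed.

Lemma rank_window_idem n (i : window X n) : rank (val (window_idem i)) = (n + n)%N.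
Proof. by rewrite [rank _](@rank_bracket X i.1 i.2 i.1 i.2) // !size_tuple. Qed.

(** A window of length [n] on both sides has rank [n + n], so sampling at length [m] recovers its
    projection exactly. *)
Lemma sample_approx n m f : (n + n <= m)%N ->
  sample m (cyl_approx X_nonempty n f) = sample n f.
Proof.
move=> nm; rewrite /cyl_approx (CY_hom_sum _ _ _ _ (sample_CY_hom m)).
by apply: eq_bigr => i _; rewrite sample_ind // rank_window_idem.
Qed.

Lemma sample_cauchy f (e : R) : 0 < e -> exists N, forall m n,
  (N <= m)%N -> (N <= n)%N -> cnorm (sample m f - sample n f) < e.
Proof.
move=> e0; have e8 : 0 < e / 8 by rewrite divr_gt0.
have [N _ hN] := cyl_approx_le X_nonempty f e8; exists N.
(* By [sample_approx] the difference is the value of [sample k] at [f - cyl_approx m f], of norm at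
   most 2 (e/8). *)
have half m k : (N <= m)%N -> (m + m <= k)%N ->
    cnorm (sample k f - sample m f) < e / 2.
  move=> Nm mk; rewrite -(sample_approx f mk) -(CY_homB _ _ (sample_CY_hom k)).
  apply: le_lt_trans (CY_hom_bound (sample_CY_hom k) e8 (hN m Nm)) _.
  by lra.
(* This [k] is at least 2m and 2n, so both samples can be compared with the one at [k]. *)
move=> m n Nm Nn; pose k := (m + m + (n + n))%N.
rewrite (le_lt_trans (cnormB _ (sample k f) _)) // [ltRHS]splitr ltrD //.
  by rewrite cnormC half // leq_addr.
by rewrite half // leq_addl.
Qed.

Definition functions_of_tight f : A :=
  projT1 (cid (cconv_ex (@sample_cauchy f))).

Lemma sample_conv f : cconv (fun n => sample n f) (functions_of_tight f).
Proof. by rewrite /functions_of_tight; case: cid. Qed.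

Lemma functions_of_tight_hom : is_CY_hom functions_of_tight.
Proof.
split.
- move=> f g; apply: cconv_unique (sample_conv _) _.
  under [X in cconv X]funext do rewrite (CYhomD (sample_CY_hom _)).
  by apply: cconvD; exact: sample_conv.
- move=> a f; apply: cconv_unique (sample_conv _) _.
  under [X in cconv X]funext do rewrite (CYhomZ (sample_CY_hom _)).
  by apply: cconvZ; exact: sample_conv.
- move=> f g; apply: cconv_unique (sample_conv _) _.
  under [X in cconv X]funext do rewrite (CYhomM (sample_CY_hom _)).
  by apply: cconvM; exact: sample_conv.
- apply: cconv_unique (sample_conv _) _; apply: cconv_near.
  by exists 0%N => n _; rewrite (CYhom1 (sample_CY_hom n)).
- move=> f; apply: cconv_unique (sample_conv _) _.
  under [X in cconv X]funext do rewrite (CYhom_star (sample_CY_hom _)).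
  by apply: cconv_star; exact: sample_conv.
Qed.

Lemma functions_of_tight_ind (e : idem S) :
  functions_of_tight (ind R (val e)) = pi (val e).
Proof.
apply: cconv_unique (sample_conv _) _; apply: cconv_near.
by exists (rank (val e)) => n; exact: sample_ind.
Qed.

End TightToFunctions.

(** * Integer powers of a unitary *)

Section UnitaryPowers.
Variables (R : realType) (A : cstarAlgType R) (u : A).
Local Open Scope ring_scope.
Hypotheses (uVu : star u * u = 1) (uuV : u * star u = 1).

Definition upow (n : int) : A :=
  match n with Posz k => u ^+ k | Negz k => star u ^+ k.+1 end.

Lemma upowS n : upow (1 + n) = u * upow n.
Proof.
case: n => [k|k]; first by rewrite -PoszD add1n /upow exprS.
have -> : 1 + Negz k = - k%:Z.
  by rewrite NegzE -addn1 PoszD opprD addrCA subrr addr0.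
rewrite /= exprS mulrA uuV mul1r; case: k => [|k]; first by rewrite !expr0.
by rewrite -NegzE.
Qed.

Lemma upowP n : upow (- 1 + n) = star u * upow n.
Proof. by rewrite -{2}(addKr (- 1) n) opprK upowS mulrA uVu mul1r. Qed.

Lemma upow_ind (P : int -> Prop) : P 0 -> (forall n, P n -> P (1 + n)) ->
  (forall n, P n -> P (- 1 + n)) -> forall n, P n.
Proof.
move=> P0 PS PP; elim=> [//|k IH|k IH]; first by rewrite -addn1 addnC PoszD; exact: PS.
by rewrite -addn1 addnC PoszD opprD; exact: PP.
Qed.

Lemma upowD m n : upow (m + n) = upow m * upow n.
Proof.
elim/upow_ind: m => [|m IH|m IH]; first by rewrite add0r mul1r.
- by rewrite -addrA !upowS IH mulrA.
- by rewrite -addrA !upowP IH mulrA.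
Qed.

Lemma upow_star n : star (upow n) = upow (- n).
Proof.
have u1 : upow 1 = u by rewrite /= expr1.
have uN1 : upow (- 1) = star u by rewrite -[- 1]addr0 upowP mulr1.
elim/upow_ind: n => [|n IH|n IH]; first by rewrite oppr0 star1.
- by rewrite upowS starM IH opprD addrC upowD uN1.
- by rewrite upowP starM IH starK opprD opprK addrC upowD u1.
Qed.
End UnitaryPowers.

(** * Elements moving the dot by one letter *)

Section ShiftElements.
Variable X : finType.
Implicit Types (z w : biseq X) (s t : SP X) (a b : X).
Local Open Scope ring_scope.

(** This acts as [sigma] restricted to the sequences whose first letter right of the dot is [a]. *)
Definition shift1 a : SP X := bracket [::] [:: a] [::].

Lemma shift1E a : [::] ++ [:: a] = [:: a] ++ [::]. Proof. by []. Qed.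

Lemma Dom_shift1 a z : Dom (shift1 a) z = (z.2 0%N == a).
Proof. by rewrite [LHS](Dom_bracket z (shift1E a)) /cyl /= andbT. Qed.

Lemma deg_shift1 a : deg (shift1 a) = 1.
Proof. by rewrite [LHS](deg_bracket (shift1E a)). Qed.

Lemma Dom_range s z : Dom (SP_mul s (SP_star s)) z = Dom s (sigma_pow (- deg s) z).
Proof. by rewrite Dom_mul Dom_star deg_star andbb. Qed.

Lemma Dom_source s z : Dom (SP_mul (SP_star s) s) z = Dom s z.
Proof. by rewrite Dom_mul Dom_star -sigma_powD addNr sigma_pow0 andbb. Qed.

(** Positive degree makes p1 nonempty. Its last letter [a] stands just left of the dot in every
    image of [s], so moving the dot back over [a] and forth again changes nothing. *)
Lemma shift1_factor (n : nat) s : deg s = n.+1%:Z -> exists a t,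
  [/\ s = SP_mul (shift1 a) t, t = SP_mul (SP_star (shift1 a)) s &
      SP_mul (SP_star t) t = SP_mul (SP_star s) s].
Proof.
case: (SP_cases s) => [->//|[r [r1 [p1 [p [e es]]]]]] ds.
have sp : (0 < size p1)%N by move: ds; rewrite es (deg_bracket e); lia.
case/lastP: p1 => // p1 a in sp e ds es *.
have sat : SP_mul (shift1 a) (SP_mul (SP_star (shift1 a)) s) = s.
  rewrite SP_mulA; apply: dots_inj => x y; rewrite dots_mul; split.
    by move=> [w [d1 d2]]; rewrite -(dots_idem _ d2) //; exact: (@idem_Mstar (SP_monoid X)).
  move=> d; exists y; split=> //.
  move: d; rewrite es => /(dots_bracket _ _ e)[u [v [_ ->]]].
  have d : dots (shift1 a) (u ++ p1, a :: p ++ v) (u ++ rcons p1 a, p ++ v).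
    apply/(dots_bracket _ _ (shift1E a)); exists (u ++ p1), (p ++ v).
    by split; rewrite ?cats0 // -cats1 catA.
  by apply/dots_mul; exists (u ++ p1, a :: p ++ v); split=> //; exact/dots_star.
exists a, (SP_mul (SP_star (shift1 a)) s); split=> //.
have -> : SP_star (SP_mul (SP_star (shift1 a)) s) = SP_mul (SP_star s) (shift1 a).
  apply: etrans (@istarM (SP_monoid X) (SP_star (shift1 a)) s) _.
  by congr SP_mul; exact: (@istarK (SP_monoid X)).
by rewrite -SP_mulA sat.
Qed.

Hypothesis X_nonempty : (0 < #|X|)%N.

(** After [SP_star (shift1 b)] the letter right of the dot is [b], whereas [shift1 a] asks for
    [a]. *)
Lemma shift1_orth a b s : a != b ->
  SP_mul (shift1 a) (SP_mul (SP_star (shift1 b)) s) = None.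
Proof.
move=> ab; apply: (Dom_empty X_nonempty) => z.
rewrite -[SP_mul _ _](esym (SP_mulA _ _ _)) Dom_mul Dom_mul Dom_star.
rewrite deg_star deg_shift1 !Dom_shift1; apply: contra ab.
by move=> /andP[_ /andP[/eqP -> /eqP ->]].
Qed.
End ShiftElements.

(** * From tight to covariant representations *)

Section TightToCovariant.
Variables (R : realType) (X : finType) (X_nonempty : (0 < #|X|)%N).
Local Notation S := (SP_monoid X).
Variables (A : cstarAlgType R) (pi : S -> A).
Hypothesis hpi : is_tight_rep pi.
Implicit Types (z w : biseq X) (s t : SP X) (f g : CY R (biseq X)) (a b : X).
Local Open Scope ring_scope.

Lemma piM s t : pi (SP_mul s t) = pi s * pi t.
Proof. exact: (tight_repM hpi). Qed.

Lemma pi_star s : pi (SP_star s) = star (pi s).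
Proof. exact: (tight_rep_star hpi). Qed.

Lemma pi0 : pi (None : SP X) = 0.
Proof. exact: (tight_rep0 hpi). Qed.

Definition shift_unitary : A := \sum_(a : X) pi (shift1 a).
Local Notation u := shift_unitary.

Lemma shift_unitary_mul a s :
  u * pi (SP_mul (SP_star (shift1 a)) s) =
  pi (SP_mul (shift1 a) (SP_mul (SP_star (shift1 a)) s)).
Proof.
rewrite /shift_unitary mulr_suml (bigD1 a) // big1 => [|b /andP[_ ba]].
  by rewrite [LHS]addr0 -piM.
by rewrite -piM shift1_orth // pi0.
Qed.

(** The sources of the elements [shift1 a] partition the space by the letter right of the dot. *)
Lemma shift_unitaryVu : star u * u = 1.
Proof.
pose c a : idem S := @idem_source S (shift1 a).
rewrite -(tight_rep_partition X_nonempty hpi (c := c)).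
- rewrite {1}/shift_unitary star_sum mulr_suml; apply: eq_bigr => a _.
  rewrite mulr_sumr (bigD1 a) // big1 => [|b /andP[_ ba]].
    by rewrite [LHS]addr0 -pi_star -piM.
  rewrite -pi_star -piM -pi0; congr pi; apply: (Dom_empty X_nonempty) => z.
  rewrite Dom_mul Dom_star !deg_shift1 -sigma_powD addNr sigma_pow0 !Dom_shift1.
  by apply: contra ba => /andP[/eqP -> /eqP ->].
- by move=> z a b; rewrite !Dom_source !Dom_shift1 => /eqP -> /eqP.
- by move=> z; exists (z.2 0%N); rewrite Dom_source Dom_shift1.
Qed.

(** The ranges of the elements [shift1 a] partition the space by the letter left of the dot. *)
Lemma shift_unitaryuV : u * star u = 1.
Proof.
pose c a : idem S := @mkidem S _ (@idem_Mstar S (shift1 a)).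
rewrite -(tight_rep_partition X_nonempty hpi (c := c)).
- rewrite {2}/shift_unitary star_sum mulr_sumr; apply: eq_bigr => a _.
  by rewrite -pi_star -[SP_star _]SP_muls1 shift_unitary_mul SP_muls1.
- by move=> z a b; rewrite !Dom_range !deg_shift1 !Dom_shift1 => /eqP -> /eqP.
- by move=> z; eexists; rewrite Dom_range deg_shift1 Dom_shift1.
Qed.

Local Notation U := (upow shift_unitary).
Local Notation rho := (functions_of_tight X_nonempty hpi).

(** A polar decomposition: for degree at least 0, split off one [shift1 a] at a time by
    [shift1_factor], each absorbed into the unitary. *)
Lemma tight_rep_factor s : pi s = U (deg s) * pi (SP_mul (SP_star s) s).
Proof.
have pos (n : nat) t : deg t = n%:Z -> pi t = U n%:Z * pi (SP_mul (SP_star t) t).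
  elim: n t => [|n IH] t dt.
    rewrite mul1r; congr pi; have tt := deg0_idem dt.
    by rewrite [SP_star t](@istar_idem S t tt) tt.
  have [a [t' [e1 e2 <-]]] := shift1_factor dt.
  rewrite e1 e2 -shift_unitary_mul -e2 -(add1n n) PoszD upowS ?shift_unitaryuV //.
  case: (pselect (t' = None)) => [->|nz]; first by rewrite pi0 !mulr0.
  rewrite -mulrA -IH //; move: nz; rewrite e2 => /deg_mul ->.
  by rewrite deg_star deg_shift1 dt -add1n PoszD addKr.
case: (leP 0 (deg s)) => [le|/ltW le].
  by apply: etrans (pos `|deg s|%N s _) _; rewrite ?gez0_abs.
(* For negative degree apply the previous case to s*; the powers of the unitary cancel and s s* s =
   s remains. *)
have := pos `|deg s|%N (SP_star s).
rewrite deg_star (lez0_abs le) => /(_ erefl) e.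
rewrite piM e.
have -> : SP_star (SP_star s) = s := @istarK S s.
rewrite -!mulrA mulrA -upowD ?shift_unitaryuV ?shift_unitaryVu // subrr mul1r.
by rewrite -piM SP_mulsVs.
Qed.

(** Both sides are homomorphisms in [f], so [CY_hom_ext] reduces the claim to indicators of nonempty
    windows. *)
Lemma conj_shift_unitary f :
  u * rho f * star u = rho (CY_act (shift_action X) 1 f).
Proof.
have hrho := functions_of_tight_hom X_nonempty hpi.
apply: (CY_hom_ext X_nonempty (F := fun f => u * rho f * star u)
  (G := fun f => rho (CY_act (shift_action X) 1 f))) => {f}.
- split.
  + by move=> f g; rewrite (CYhomD hrho) mulrDr mulrDl.
  + by move=> a f; rewrite (CYhomZ hrho) -scalerAr -scalerAl.
  + move=> f g; rewrite (CYhomM hrho) -!mulrA (mulrA (star u)) shift_unitaryVu.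
    by rewrite mul1r !mulrA.
  + by rewrite (CYhom1 hrho) mulr1 shift_unitaryuV.
  + by move=> f; rewrite (CYhom_star hrho) !starM starK mulrA.
- split.
  + by move=> f g; rewrite -(CYhomD hrho); congr (rho _); exact: CY_eq.
  + by move=> a f; rewrite -(CYhomZ hrho); congr (rho _); exact: CY_eq.
  + by move=> f g; rewrite -(CYhomM hrho); congr (rho _); exact: CY_eq.
  + by rewrite -(CYhom1 hrho); congr (rho _); exact: CY_eq.
  + by move=> f; rewrite -(CYhom_star hrho); congr (rho _); exact: CY_eq.
case=> [//|n] i _.
set e := window_idem i; pose a := thead i.2.
have ea z : Dom (val e) z -> z.2 0%N = a.
  rewrite Dom_cyl_elt /cyl [tval i.2](congr1 (@tval _ _) (tuple_eta i.2)).
  by move=> /andP[_ /andP[/eqP]].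
(* The window [e] fixes the letter [a] right of the dot, so only one summand of the unitary survives
   on it: u e = s, and u e u* = s s* is an idempotent with the shifted domain. *)
pose s := SP_mul (shift1 a) (val e).
have Ds z : Dom s z = Dom (val e) z.
  rewrite Dom_mul deg_val sigma_pow0 Dom_shift1.
  by case d: (Dom _ _); rewrite // (ea _ d) eqxx.
have [z0 ez0] := exists_cyl X_nonempty i.1 i.2.
have ds : deg s = 1.
  rewrite deg_mul ?deg_val ?deg_shift1 // => s0.
  by have := Ds z0; rewrite [s]s0 Dom_cyl_elt ez0.
have ue : u * pi (val e) = pi s.
  rewrite /shift_unitary mulr_suml (bigD1 a) // big1 => [|b /andP[_ ba]].
    by rewrite [LHS]addr0 -piM.
  rewrite -piM -pi0; congr pi; apply: (Dom_empty X_nonempty) => z.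
  rewrite Dom_mul deg_val sigma_pow0 Dom_shift1; apply: contra ba.
  by move=> /andP[/ea -> /eqP ->].
have pe : pi (val e) = pi (val e) * star (pi (val e)).
  by rewrite -pi_star -piM [SP_star _](istar_idem (idemP e)) [SP_mul _ _](idemP e).
rewrite functions_of_tight_ind pe mulrA -mulrA -starM ue -pi_star -piM.
have <- := functions_of_tight_ind X_nonempty hpi (@mkidem S _ (@idem_Mstar S s)).
congr (rho _); apply: CY_eq => z.
by rewrite CY_actE !indE Dom_range ds Ds.
Qed.

Lemma tight_to_covariant : is_covariant_rep (shift_action X) rho U.
Proof.
have hrho := functions_of_tight_hom X_nonempty hpi.
have uV := shift_unitaryVu; have uuV := shift_unitaryuV.
split; try by case: hrho.
- by move=> m n; exact: upowD.
- exact: upow_star.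
move=> n f; rewrite upow_star //.
elim/upow_ind: n => [|n IH|n IH].
- by rewrite oppr0 mul1r mulr1; congr (rho _); apply: CY_eq => z; rewrite CY_actE.
- rewrite opprD [- 1 - n]addrC upowS // upowD // [U (- 1)]expr1.
  rewrite -!mulrA (mulrA (U n)) (mulrA (U n * _)) IH mulrA conj_shift_unitary.
  by congr (rho _); apply: CY_eq => z; rewrite !CY_actE opprD addrC sigma_powD.
rewrite opprD opprK [1 - n]addrC upowP // upowD // [U 1]expr1.
rewrite -!mulrA (mulrA (U n)) (mulrA (U n * _)) IH.
set g := CY_act _ n f.
(* Written as a shift by one, [g] is a conjugate by u, which the outer u* and u undo. *)
have -> : g = CY_act (shift_action X) 1 (CY_act (shift_action X) (-1 + n) f).
  by apply: CY_eq => z; rewrite !CY_actE -sigma_powD opprD opprK addrAC subrr add0r.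
by rewrite -conj_shift_unitary mulrA !mulrA uV mul1r -mulrA uV mulr1.
Qed.

End TightToCovariant.

(** * Comparison of the two universal algebras *)

Section Isomorphism.
Variables (R : realType) (X : finType) (X_nonempty : (0 < #|X|)%N).
Local Open Scope ring_scope.
Local Open Scope complex_scope.

Lemma is_star_hom_id (A : cstarAlgType R) : is_star_hom (@id A).
Proof. by split. Qed.

Lemma is_star_hom_comp (A B C : cstarAlgType R) (phi : A -> B) (psi : B -> C) :
  is_star_hom phi -> is_star_hom psi -> is_star_hom (fun x => psi (phi x)).
Proof.
move=> h k; split.
- by move=> x y; rewrite (star_homD h) (star_homD k).
- by move=> a x; rewrite (star_homZ h) (star_homZ k).
- by move=> x y; rewrite (star_homM h) (star_homM k).
- by rewrite (star_hom1 h) (star_hom1 k).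
- by move=> x; rewrite (star_hom_star h) (star_hom_star k).
Qed.

Lemma star_hom_CY_hom (Y : topologicalType) (A B : cstarAlgType R)
    (phi : A -> B) (F : CY R Y -> A) :
  is_star_hom phi -> is_CY_hom F -> is_CY_hom (fun f => phi (F f)).
Proof.
move=> h k; split.
- by move=> x y; rewrite (CYhomD k) (star_homD h).
- by move=> a x; rewrite (CYhomZ k) (star_homZ h).
- by move=> x y; rewrite (CYhomM k) (star_homM h).
- by rewrite (CYhom1 k) (star_hom1 h).
- by move=> x; rewrite (CYhom_star k) (star_hom_star h).
Qed.

(** The two universal properties give homomorphisms in both directions; each composite fixes the
    generators and is the identity by uniqueness. *)
Lemma Cstar_tight_crossed_product (Q : cstarAlgType R) (pi : SP_monoid X -> Q)
    (B : cstarAlgType R) (rho : CY R (biseq X) -> B) (U : int -> B) :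
  is_Cstar_tight pi -> is_crossed_product (shift_action X) rho U -> cstar_iso Q B.
Proof.
move=> [hpi univQ] [hcov univB].
have htau := tight_of_cov_tight X_nonempty hcov.
have hcov' := tight_to_covariant X_nonempty hpi.
have [phi [[hphi phipi] _]] := univQ _ _ htau.
have [psi [[hpsi psirho psiU] _]] := univB _ _ _ hcov'.
have hrho := covariant_CY_hom hcov.
exists phi; split=> //; exists psi => [q|b].
  have [chi [_ uniq]] := univQ _ _ hpi.
  suff e : (fun x => psi (phi x)) = id by exact: (congr1 (fun f => f q) e).
  rewrite -[LHS](uniq (fun x => psi (phi x))); last first.
    split; first exact: is_star_hom_comp.
    (* The image of [pi s] is U^(deg s) times the projection of the source of [s], which is [pi s]
       by [tight_rep_factor]. *)
    move=> s; rewrite phipi /tight_of_cov (star_homM hpsi) psirho psiU.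
    rewrite [RHS](tight_rep_factor X_nonempty hpi); congr (_ * _).
    have := functions_of_tight_ind X_nonempty hpi (@idem_source _ s).
    rewrite [val _]/= => <-; congr (functions_of_tight _ _ _).
    by apply: CY_eq => z; rewrite !indE Dom_source.
  by apply: uniq; split; first exact: is_star_hom_id.
have [chi [_ uniq]] := univB _ _ _ hcov.
suff e : (fun x => phi (psi x)) = id by exact: (congr1 (fun f => f b) e).
have phirho f : phi (functions_of_tight X_nonempty hpi f) = rho f.
  apply: (CY_hom_ext X_nonempty
    (F := fun f => phi (functions_of_tight X_nonempty hpi f)) _ hrho) => [|n i _].
    apply: star_hom_CY_hom => //; exact: functions_of_tight_hom.
  rewrite functions_of_tight_ind phipi; exact: tight_of_cov_idem.
have phi0 : phi 0 = 0 by rewrite -(scale0r (0 : Q)) (star_homZ hphi) scale0r.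
have phiu : phi (shift_unitary pi) = U 1.
  rewrite /shift_unitary (big_morph phi (star_homD hphi) phi0).
  (* The indicators of the domains of the [shift1 a] sum to the constant 1. *)
  transitivity (U 1 * rho (\sum_(a : X) (1 : R[i]) *: ind R (shift1 a))).
    rewrite CY_hom_sum // mulr_sumr; apply: eq_bigr => a _.
    by rewrite phipi /tight_of_cov deg_shift1 scale1r.
  rewrite -[RHS]mulr1 -(CYhom1 hrho); congr (_ * rho _); apply: CY_eq => z.
  rewrite CY_sumE (bigD1 (z.2 0%N)) // big1 => [|a /andP[_ az]].
    by rewrite [LHS]addr0 CY_scaleE indE Dom_shift1 eqxx mulr1.
  by rewrite CY_scaleE indE Dom_shift1 eq_sym (negbTE az) mulr0.
have phiU n : phi (upow (shift_unitary pi) n) = U n.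
  have uV := shift_unitaryVu X_nonempty hpi.
  have uuV := shift_unitaryuV X_nonempty hpi.
  elim/upow_ind: n => [|n IH|n IH].
  - by rewrite (star_hom1 hphi) (covU0 hcov).
  - by rewrite upowS // (star_homM hphi) IH phiu (covUD hcov).
  - rewrite upowP // (star_homM hphi) IH (star_hom_star hphi) phiu.
    by rewrite (covU_star hcov) -(covUD hcov).
rewrite -[LHS](uniq (fun x => phi (psi x))); last first.
  split; first exact: is_star_hom_comp.
  - by move=> f; rewrite psirho.
  - by move=> n; rewrite psiU.
by apply: uniq; split; first exact: is_star_hom_id.
Qed.
End Isomorphism.

Theorem theorem4p3 (R : realType) (X : finType) (X_nonempty : (0 < #|X|)%N) :
  topGroupoid_iso (tight_groupoid (SP_monoid X))
                  (trans_groupoid (shift_action X)) /\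
  (forall (Q : cstarAlgType R) (pi : SP_monoid X -> Q)
          (B : cstarAlgType R) (rho : CY R (biseq X) -> B) (U : int -> B),
     is_Cstar_tight pi -> is_crossed_product (shift_action X) rho U ->
     cstar_iso Q B).
Proof.
split; first exact: tight_groupoid_shift_iso.
by move=> Q pi B rho U; exact: Cstar_tight_crossed_product.
Qed.
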